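(* Let $d\geq 3$, let $\mathcal{Q}$ be a finite abstract $d$-polytope, and let $\Gamma$ be a subgroup of $\Gamma(\mathcal{Q})$. Then there exists a finite abstract $d$-polytope $\mathcal{P}$ with the following properties: (a) $\Gamma(\mathcal{P})=\Gamma$. (b) $\mathcal{P}$ is isomorphic to a face-to-face tessellation of the topological space $|\mathcal{C}(\mathcal{Q})|$ of the order complex $\mathcal{C}(\mathcal{Q})$ of $\mathcal{Q}$ by topological copies of convex polytopes. (c) ${\rm skel}_{d-2}(\mathcal{C}(\mathcal{Q}))$ is a subcomplex of ${\rm skel}_{d-2}(\mathcal{P})$.
   Context: An abstract polytope of rank $d$ is a ranked poset with a least face (rank $-1$) and greatest face (rank $d$), in which every flag (maximal chain) has $d+2$ elements, which is strongly flag-connected and satisfies the diamond condition. $\Gamma(\cdot)$ denotes the automorphism group (order-preserving bijections). The order complex $\mathcal{C}(\mathcal{Q})$ is the simplicial complex whose simplices are the chains of proper faces of $\mathcal{Q}$ (a combinatorial barycentric subdivision of $\mathcal{Q}$, with maximal simplices corresponding to flags), and $|\mathcal{C}(\mathcal{Q})|$ is its geometric realization. ${\rm skel}_k$ denotes the set of proper faces of rank (dimension) at most $k$; (c) means that all simplices of $\mathcal{C}(\mathcal{Q})$ of dimension at most $d-2$ occur unrefined as faces of the tessellation representing $\mathcal{P}$. *)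

(* Defs.v *)
From HB Require Import structures.
From mathcomp Require Import all_boot all_order all_algebra all_fingroup.
From mathcomp Require Import all_classical all_reals all_analysis.
Set Implicit Arguments. Unset Strict Implicit. Unset Printing Implicit Defensive.
Import Order.TTheory GRing.Theory Num.Theory.
Import numFieldNormedType.Exports.

Section Poset.
Variables (T : finType) (le : rel T).

Definition is_partial_order : Prop :=
  [/\ reflexive le, antisymmetric le & transitive le].

Definition ltP (x y : T) : bool := (x != y) && le x y.

Definition is_chain (c : {set T}) : bool :=
  [forall x in c, forall y in c, le x y || le y x].

Definition is_flag (c : {set T}) : bool :=
  is_chain c && [forall x, is_chain (x |: c) ==> (x \in c)].

(* rk F = number of elements of a longest chain of faces below F
   (including F); the rank of F in the usual sense is rk F - 2, so the
   least face (rank -1) has rk = 1 and a face of rank d has rk = d+2. *)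
Definition rk (F : T) : nat :=
  \max_(c : {set T} | is_chain c && (c \subset [set G | le G F])) #|c|.

Definition diamond_condition : Prop :=
  forall F G, ltP F G -> rk G = (rk F + 2)%N ->
    #|[set H | ltP F H && ltP H G]| = 2%N.

Definition adjacent_flags (A B : {set T}) : bool := #|A :\: B| == 1%N.

Definition strongly_flag_connected : Prop :=
  forall Phi Psi : {set T}, is_flag Phi -> is_flag Psi ->
    exists s : seq {set T},
      [/\ seq.all (@is_flag) s, path adjacent_flags Phi s, last Phi s = Psi
        & seq.all (fun X : {set T} => (Phi :&: Psi) \subset X) s].

Definition abstract_polytope (d : nat) : Prop :=
  [/\ is_partial_order,
      (exists Fmin, forall y, le Fmin y),
      (exists Fmax, forall y, le y Fmax),
      (forall Phi, is_flag Phi -> #|Phi| = (d + 2)%N)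
    & diamond_condition /\ strongly_flag_connected].

Definition proper_face (F : T) : bool :=
  [exists y, ~~ le F y] && [exists y, ~~ le y F].

Definition Aut_poset : {set {perm T}} :=
  [set s : {perm T} | [forall x, forall y, le (s x) (s y) == le x y]].

End Poset.

Local Open Scope classical_set_scope.
Local Open Scope ring_scope.

Section Geometry.
Variable R : realType.

Definition homeo_onto {m n : nat} (A : set 'rV[R]_m) (B : set 'rV[R]_n)
    (f : 'rV[R]_m -> 'rV[R]_n) : Prop :=
  {within A, continuous f} /\
  exists g : 'rV[R]_n -> 'rV[R]_m,
    [/\ {within B, continuous g},
        (forall x, A x -> B (f x) /\ g (f x) = x)
      & (forall y, B y -> A (g y) /\ f (g y) = y)].

Definition conv_hull {k : nat} (S : seq 'rV[R]_k) : set 'rV[R]_k :=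
  [set x | exists w : 'I_(size S) -> R,
     [/\ forall i, 0 <= w i, \sum_i w i = 1
       & x = \sum_i w i *: S`_i]].

Definition dotr {k : nat} (a x : 'rV[R]_k) : R := \sum_i a 0 i * x 0 i.

(* nonempty faces of a convex set K: intersections with supporting
   hyperplanes (a = 0, b = 0 gives K itself) *)
Definition face_of {k : nat} (K A : set 'rV[R]_k) : Prop :=
  A !=set0 /\
  exists (a : 'rV[R]_k) (b : R),
    (forall x, K x -> dotr a x <= b) /\ A = K `&` [set x | dotr a x = b].

(* Realization |C(Q)| of the order complex of a finite poset (TQ, le),
   embedded in R^{#|TQ|} (barycentric coordinates indexed by faces). *)
Section Realization.
Variables (TQ : finType) (leQ : rel TQ).
Let E := 'rV[R]_#|TQ|.

Definition bcoord (x : E) (F : TQ) : R := x 0 (enum_rank F).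

Definition geom_simplex (c : {set TQ}) : set E :=
  [set x | [/\ forall F, 0 <= bcoord x F, \sum_F bcoord x F = 1
             & forall F, bcoord x F != 0 -> F \in c]].

Definition oc_simplex (c : {set TQ}) : bool :=
  [&& is_chain leQ c, c != finset.set0 & [forall F in c, proper_face leQ F]].

Definition realization : set E :=
  [set x | exists c, oc_simplex c /\ geom_simplex c x].

End Realization.

(* (TP, leP) of rank d is isomorphic to a face-to-face tessellation of the
   space X by topological copies of convex polytopes, via cell :
   proper faces of P correspond to cells (faces of tiles), facets of P
   to the tiles. *)
Definition tessellation_iso (TP : finType) (leP : rel TP) (d : nat) {n : nat}
    (X : set 'rV[R]_n) (cell : TP -> set 'rV[R]_n) : Prop :=
  let facet F := proper_face leP F && (rk leP F == d.+1) in
  [/\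
      (forall F G, proper_face leP F -> proper_face leP G ->
         (leP F G <-> cell F `<=` cell G)),
      (forall F, proper_face leP F -> cell F `<=` X),
      (forall x, X x -> exists F, facet F /\ cell F x),
      (forall F, facet F ->
         exists (k : nat) (S : seq 'rV[R]_k) (h : 'rV[R]_k -> 'rV[R]_n),
         [/\ homeo_onto (conv_hull S) (cell F) h,
             (forall G, proper_face leP G -> leP G F ->
                exists A, face_of (conv_hull S) A /\ cell G = h @` A)
           & (forall A, face_of (conv_hull S) A ->
                exists G, [/\ proper_face leP G, leP G F & cell G = h @` A])])
    &
      (forall F1 F2, facet F1 -> facet F2 ->
         cell F1 `&` cell F2 = set0 \/
         exists G, proper_face leP G /\ cell F1 `&` cell F2 = cell G)].

End Geometry.

(* Main.v *)
(* Start from the order complex of Q, whose facets correspond to the flags of Q.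
   Subdividing a facet by coning from its barycentre keeps all faces of dimension
   at most d - 2, keeps the complex a strongly connected simplicial
   pseudomanifold, and adds one vertex lying in exactly d facets.  In the order
   complex every vertex lies in more than d facets.  Choose a facet tau; its
   orbit under Gamma is free.  Subdivide the whole orbit of tau, then replace tau
   by a new facet inside it that omits one original vertex, and repeat until every
   vertex of tau is new; then subdivide once more.  At each step the new vertices
   are exactly those of degree d, so an automorphism of the final complex descends
   through all the steps and preserves every subdivided orbit.  Up to an element
   of Gamma it therefore fixes tau vertex by vertex, and an automorphism of a
   strongly connected pseudomanifold that fixes a facet pointwise is the identity.
   All tiles are geometric simplices. *)
Require Import Defs.
From HB Require Import structures.
From mathcomp Require Import all_boot all_order all_fingroup.
From mathcomp Require Import zify.
Set Implicit Arguments. Unset Strict Implicit. Unset Printing Implicit Defensive.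

(** * Chains and ranks *)

(** The obstacle is that the order complex may have many more automorphisms than [Gamma]:
    automorphisms of [Q] outside [Gamma], dualities, and possibly others. So nothing is assumed
    about them at the start. Once the orbit of tau is known to be preserved, the freedom left modulo
    [Gamma] is a permutation of the d vertices of tau. Each round puts exactly one new vertex into
    tau, and an automorphism that descends through the rounds sends it to a new vertex of the same
    round; vertices of different rounds can therefore not be interchanged. The extra subdivision at
    the end is what forces every automorphism to preserve the orbit of the final tau. The bound d >=
    3 enters the comparison of degrees: a vertex of a subdivided facet lies in d - 1 >= 2 of its
    children, so its degree strictly grows and it cannot be mistaken for a new vertex. Every cell
    stays a straight simplex in one ambient space, so the underlying point set never changes. *)

Section Chains.
Variables (T : finType) (le : rel T).
Implicit Types (c Phi : {set T}) (x y F : T).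

Lemma chainP c :
  reflect {in c &, forall x y, le x y || le y x} (is_chain le c).
Proof.
apply: (iffP forall_inP) => [h x y xc yc|h x xc].
  exact: (forall_inP (h x xc)).
by apply/forall_inP => y yc; exact: h.
Qed.

Lemma sub_chain c c' : c \subset c' -> is_chain le c' -> is_chain le c.
Proof.
move=> /subsetP s /chainP h; apply/chainP => x y /s xc /s; exact: h.
Qed.

Lemma chainU1 x c : reflexive le -> is_chain le c ->
  {in c, forall y, le x y || le y x} -> is_chain le (x |: c).
Proof.
move=> lexx /chainP h hx; apply/chainP => y z.
case/setU1P => [->|yc] /setU1P[->|zc].
- by rewrite lexx.
- exact: hx.
- by rewrite orbC hx.
- exact: h.
Qed.

Lemma flag_chain Phi : is_flag le Phi -> is_chain le Phi.
Proof. by case/andP. Qed.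

Lemma mem_flag Phi x : reflexive le -> is_flag le Phi ->
  {in Phi, forall y, le x y || le y x} -> x \in Phi.
Proof.
move=> lexx /andP[ch /forallP/(_ x)/implyP mx] h.
exact/mx/chainU1.
Qed.

Lemma chain_sub_flag c : is_chain le c -> exists2 Phi, is_flag le Phi & c \subset Phi.
Proof.
move=> ch; have [Phi /maxsetP[chP mx] s] := maxset_exists ch.
exists Phi => //; apply/andP; split=> //; apply/forallP => x; apply/implyP => h.
by rewrite -(mx _ h (subsetUr _ _)) setU11.
Qed.

Variable N : nat.
Hypothesis flagN : forall Phi, is_flag le Phi -> #|Phi| = N.

Lemma chain_flag_card c : is_chain le c -> #|c| = N -> is_flag le c.
Proof.
move=> ch cN; have [Phi fP s] := chain_sub_flag ch.
have -> // : c = Phi.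
by apply/eqP; rewrite eqEcard s cN (flagN fP) /=.
Qed.

Lemma chain_leq_card c : is_chain le c -> #|c| <= N.
Proof.
by move=> ch; have [Phi fP s] := chain_sub_flag ch; rewrite -(flagN fP) subset_leq_card.
Qed.

Hypothesis po : is_partial_order le.

(** A chain below [F], joined to the part of [Phi] not below [F], is again a chain and so has at
    most [N] elements. Hence no chain below [F] is longer than the one inside [Phi], and ranks can
    be counted in any flag. *)
Lemma rk_flag Phi F : is_flag le Phi -> F \in Phi ->
  rk le F = #|[set y in Phi | le y F]|.
Proof.
have [lexx anti tr] := po; move=> fP FP; have chP := flag_chain fP.
apply/eqP; rewrite eqn_leq; apply/andP; split; last first.
  apply: leq_bigmax_cond; rewrite (sub_chain _ chP) /=; last first.
    by apply/subsetP => x; rewrite inE => /andP[].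
  by apply/subsetP => x; rewrite !inE => /andP[].
apply/bigmax_leqP => c /andP[chc /subsetP cF].
rewrite -(leq_add2r #|[set y in Phi | ~~ le y F]|).
have -> : #|[set y in Phi | le y F]| + #|[set y in Phi | ~~ le y F]| = N.
  rewrite -(flagN fP) -(cardsID [set y | le y F] Phi); congr (_ + _).
    by apply: eq_card => y; rewrite !inE.
  by apply: eq_card => y; rewrite !inE andbC.
have dis : [disjoint c & [set y in Phi | ~~ le y F]].
  apply/pred0P => y /=; apply/negP => /andP[/cF]; rewrite !inE => ->.
  by rewrite andbF.
move: dis; rewrite -(leq_card_setU _ _).2 => /eqP <-.
apply/chain_leq_card/chainP => x y.
have hlt z : z \in Phi -> ~~ le z F -> le F z.
  by move=> zP zF; have := chainP _ chP _ _ zP FP; rewrite (negbTE zF).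
have up a b : a \in c -> b \in Phi -> ~~ le b F -> le a b.
  move=> /cF; rewrite inE => aF bP bF; exact: tr aF (hlt _ bP bF).
rewrite !inE => /orP[xc|/andP[xP xF]] /orP[yc|/andP[yP yF]].
- exact: (chainP _ chc).
- by rewrite up.
- by rewrite orbC up.
- exact: (chainP _ chP).
Qed.

End Chains.

Lemma proper_faceE (T : finType) (le : rel T) (bot top x : T) :
  is_partial_order le -> (forall y, le bot y) -> (forall y, le y top) ->
  proper_face le x = (x != bot) && (x != top).
Proof.
move=> [_ anti _] le_bot le_top; congr (_ && _); apply/existsP/idP => [[y]|].
- by apply: contraNneq => ->.
- by move=> xb; exists bot; apply: contra xb => h; apply/eqP/anti; rewrite h le_bot.
- by apply: contraNneq => ->.
- by move=> xt; exists top; apply: contra xt => h; apply/eqP/anti; rewrite h le_top.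
Qed.

(** * Simplicial pseudomanifolds and their face posets *)

Section Pseudomanifold.
Variables (V : finType) (d : nat) (F : {set {set V}}).
Implicit Types (A B C s : {set V}) (f g : V -> V).

(** Keeping [s] inside both facets makes connectivity that of the star of [s]. With [<= 1] a facet
    is its own neighbour, so equal facets need no separate case. *)
Definition facet_nbr s A B :=
  [&& A \in F, B \in F, s \subset A, s \subset B & #|A :\: B| <= 1].

(** [d] counts the vertices of a facet, whose dimension is [d - 1]. [pm_ridge] is the source of the
    diamond condition for the top face; [pm_connect], required for the star of every [s], is the
    source of strong flag-connectedness. *)
Record pseudomanifold : Prop := Pseudomanifold {
  pm_cover : forall v, exists2 A, A \in F & v \in A;
  pm_facet : exists A, A \in F;
  pm_card : forall A, A \in F -> #|A| = d;
  pm_ridge : forall A s, A \in F -> s \subset A -> #|s| = d.-1 ->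
    #|[set B in F | s \subset B]| = 2;
  pm_connect : forall s A B, A \in F -> B \in F -> s \subset A -> s \subset B ->
    connect (facet_nbr s) A B }.

(** By finiteness such a map permutes both the vertices and the facets, so no inverse is asked
    for. *)
Definition simplicial_aut f :=
  injective f /\ (forall A, A \in F -> f @: A \in F).

Definition simplex A := [exists B in F, A \subset B].

Lemma simplexP A : reflect (exists2 B, B \in F & A \subset B) (simplex A).
Proof. exact: (iffP exists_inP). Qed.

Lemma simplex_sub A B : A \subset B -> simplex B -> simplex A.
Proof.
move=> AB /simplexP[C CF BC]; apply/simplexP; exists C => //; exact: subset_trans BC.
Qed.

Lemma facet_simplex A : A \in F -> simplex A.
Proof. by move=> AF; apply/simplexP; exists A. Qed.

Hypothesis pm : pseudomanifold.

Lemma simplex_card A : simplex A -> #|A| <= d.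
Proof.
by case/simplexP => B BF AB; rewrite -(pm_card pm BF) subset_leq_card.
Qed.

Lemma simplex_facet A : simplex A -> #|A| = d -> A \in F.
Proof.
case/simplexP => B BF AB cA.
have -> // : A = B.
by apply/eqP; rewrite eqEcard AB cA (pm_card pm BF) leqnn.
Qed.

Lemma facet_capC A B : A \in F -> B \in F -> #|A :\: B| = #|B :\: A|.
Proof.
by move=> AF BF; rewrite !cardsD (setIC B) (pm_card pm AF) (pm_card pm BF).
Qed.

Lemma nbr_cap s A B : facet_nbr s A B -> A != B -> #|A :&: B| = d.-1.
Proof.
case/and5P=> AF BF _ _ AB nAB.
have := cardsID B A; rewrite (pm_card pm AF).
have : 0 < #|A :\: B|.
  rewrite lt0n cards_eq0; apply: contra nAB; rewrite setD_eq0 => sAB.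
  by rewrite eqEcard sAB (pm_card pm AF) (pm_card pm BF) leqnn.
lia.
Qed.

Lemma ridge_unique s A B C : A \in F -> B \in F -> C \in F ->
  s \subset A -> s \subset B -> s \subset C -> #|s| = d.-1 ->
  B != A -> C != A -> B = C.
Proof.
move=> AF BF CF sA sB sC cs BA CA; apply/eqP; apply: contraT => BC.
have := pm_ridge pm AF sA cs.
have : [set A; B; C] \subset [set B in F | s \subset B].
  by apply/subsetP => X; rewrite !inE => /orP[/orP[]|] /eqP ->; apply/andP.
move/subset_leq_card => + e; rewrite {}e.
rewrite -setUA cardsU1 cards2 !inE BC.
by rewrite eq_sym (negbTE BA) eq_sym (negbTE CA).
Qed.

(** Agreement crosses ridges: [f] and [g] agree on the ridge shared with the next facet [C] and give
    [A] the same image, so [C] goes to the unique other facet through the image ridge, and its one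
    remaining vertex has a single possible image. *)
Lemma aut_rigid f g A : simplicial_aut f -> simplicial_aut g -> A \in F ->
  {in A, f =1 g} -> f =1 g.
Proof.
move=> [fi fF] [gi gF] AF fgA v; have [B BF vB] := pm_cover pm v.
suff fgB : {in B, f =1 g} by exact: fgB.
have /connectP[p pp ->] := pm_connect pm AF BF (sub0set _) (sub0set _).
elim: p A pp {AF} fgA => [|C p IH] //= A /andP[nAC pC] fgA; apply: IH pC _ => {p}.
move=> w wC; have [wA|wA] := boolP (w \in A); first exact: fgA.
have nAC' : A != C by apply: contraNneq wA => ->.
have cs := nbr_cap nAC nAC'; case/and5P: nAC => AF CF _ _ AC.
have CA : #|C :\: A| == 1.
  rewrite (facet_capC CF AF) eqn_leq AC lt0n cards_eq0 setD_eq0.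
  apply: contra nAC' => sAC.
  by rewrite eqEcard sAC (pm_card pm AF) (pm_card pm CF) leqnn.
have efg : f @: (A :&: C) = g @: (A :&: C).
  by apply: eq_in_imset => z /setIP[/fgA].
have efgA : f @: A = g @: A by apply: eq_in_imset.
have e : f @: C = g @: C.
  apply: (@ridge_unique (f @: (A :&: C)) (f @: A)); rewrite ?fF ?gF //.
  - by rewrite imsetS ?subsetIl.
  - by rewrite imsetS ?subsetIr.
  - by rewrite efg imsetS ?subsetIr.
  - by rewrite card_imset.
  - by rewrite (inj_eq (imset_inj fi)) eq_sym.
  - by rewrite efgA (inj_eq (imset_inj gi)) eq_sym.
have : f w \in g @: C by rewrite -e imset_f.
case/imsetP => u uC fwu.
(* If [u] were in [A], agreement there and injectivity of [f] would give [u = w]. As [C] has only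
   one vertex outside [A], [u] and [w] coincide. *)
have uA : u \notin A.
  apply: contra wA => uA; move: fwu; rewrite -fgA // => /fi -> //.
case/cards1P: CA => z ez.
have : w \in C :\: A by rewrite inE wA.
have : u \in C :\: A by rewrite inE uA.
by rewrite ez !inE fwu => /eqP -> /eqP ->.
Qed.

End Pseudomanifold.

(** * The face poset of a pseudomanifold is an abstract polytope *)

Section FacePoset.
Variables (V : finType) (d : nat) (F : {set {set V}}).

(** The full vertex set plays the greatest face, so that inclusion is the whole order; by [simplexT]
    it never clashes with a simplex. *)
Definition is_face (A : {set V}) := (A == [set: V]) || simplex F A.
Definition face := {A : {set V} | is_face A}.
Definition face_le : rel face := fun a b => val a \subset val b.
Implicit Types (a b : face) (c Phi Psi : {set face}) (A B : {set V}).

Hypothesis d2 : 2 <= d.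
Hypothesis pm : pseudomanifold d F.

Lemma is_face0 : is_face set0.
Proof.
by have [A AF] := pm_facet pm; apply/orP; right; apply/simplexP; exists A; rewrite ?sub0set.
Qed.

Lemma is_faceT : is_face setT. Proof. by rewrite /is_face eqxx. Qed.

Definition fbot : face := Sub set0 is_face0.
Definition ftop : face := Sub setT is_faceT.

(** Were all vertices to form a simplex, there would be only one facet, and its ridges would lie in
    one facet instead of two. *)
Lemma simplexT : ~~ simplex F [set: V].
Proof.
apply/negP => /simplexP[A AF]; rewrite subTset => /eqP AT.
have [v vA] : exists v, v \in A.
  by apply/card_gt0P; rewrite (pm_card pm AF); lia.
have := pm_ridge pm AF (subsetDl A [set v]); rewrite AT.
have cA : #|[set: V] :\ v| = d.-1.
  by have := pm_card pm AF; rewrite (cardsD1 v) vA AT; lia.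
move=> /(_ cA).
have -> : [set B in F | [set: V] :\ v \subset B] = [set A].
  apply/setP => B; rewrite !inE; apply/andP/eqP => [[BF _]|->].
    by apply/eqP; rewrite eqEcard AT subsetT -AT (pm_card pm AF) (pm_card pm BF) leqnn.
  by rewrite AF AT subsetT.
by rewrite cards1.
Qed.

Lemma face_le_po : is_partial_order face_le.
Proof.
split=> [a|a b|b a c]; rewrite /face_le ?subxx //.
  by rewrite -eqEsubset => /eqP/val_inj.
exact: subset_trans.
Qed.

Lemma face_lexx : reflexive face_le. Proof. by case: face_le_po. Qed.

Lemma facePT a : a = ftop \/ simplex F (val a).
Proof. by case/orP: (valP a) => [/eqP e|->]; [left; exact: val_inj|right]. Qed.

Lemma simplex_neqT a : simplex F (val a) = (a != ftop).
Proof.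
case: (facePT a) => [->|sa]; first by rewrite eqxx (negbTE simplexT).
by rewrite sa; apply/esym; apply: contraTneq sa => ->; exact: simplexT.
Qed.

Definition face_of_simplex A (sA : simplex F A) : face :=
  Sub A (introT orP (or_intror sA)).

Lemma fbot_min a : face_le fbot a. Proof. exact: sub0set. Qed.
Lemma ftop_max a : face_le a ftop. Proof. exact: subsetT. Qed.

(* the rank shifted by one: the empty face has dimension 0, not -1 *)
Definition fdim a := if a == ftop then d.+1 else #|val a|.

Lemma fdim_top : fdim ftop = d.+1. Proof. by rewrite /fdim eqxx. Qed.

Lemma fdim_simplex a : simplex F (val a) -> fdim a = #|val a|.
Proof. by rewrite /fdim simplex_neqT => /negbTE ->. Qed.

Lemma fdim_leq a : fdim a <= d.+1.
Proof.
rewrite /fdim; case: eqP => // /eqP; rewrite -simplex_neqT => /(simplex_card pm).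
exact: leqW.
Qed.

Lemma face_le_dim a b : face_le a b -> fdim a <= fdim b.
Proof.
move=> ab; have [->|nb] := eqVneq b ftop.
  by rewrite fdim_top fdim_leq.
have sb : simplex F (val b) by rewrite simplex_neqT.
by rewrite !fdim_simplex ?subset_leq_card // (simplex_sub ab).
Qed.

Lemma face_le_dim_eq a b : face_le a b -> fdim b <= fdim a -> a = b.
Proof.
move=> ab ba; have [bT|nb] := eqVneq b ftop.
  move: ba; rewrite bT fdim_top; case: (facePT a) => // sa.
  by rewrite fdim_simplex // => h; have := simplex_card pm sa; lia.
have sb : simplex F (val b) by rewrite simplex_neqT.
apply/val_inj/eqP; rewrite eqEcard; apply/andP; split=> //.
by rewrite -!fdim_simplex // (simplex_sub ab).
Qed.

Section Chain.
Variable c : {set face}.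
Hypothesis ch : is_chain face_le c.

Lemma chain_dim_le a b : a \in c -> b \in c -> fdim a <= fdim b -> face_le a b.
Proof.
move=> ac bc ab; case/orP: (chainP _ _ ch _ _ ac bc) => // ba.
by rewrite (face_le_dim_eq ba ab) face_lexx.
Qed.

Lemma chain_dim_inj : {in c &, injective fdim}.
Proof.
move=> a b ac bc e; apply: face_le_dim_eq; last by rewrite e.
by apply: chain_dim_le; rewrite ?e.
Qed.
End Chain.

(** If the flag skips [k], take its neighbours [a] below and [b] above the gap. Adding one vertex to
    [a] inside [b] gives a face comparable to the whole flag; maximality puts it in the flag,
    against the choice of [a]. *)
Lemma flag_dim Phi k : is_flag face_le Phi -> k <= d.+1 ->
  exists2 a, a \in Phi & fdim a = k.
Proof.
move=> fP kd; have ch := flag_chain fP.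
have botP : fbot \in Phi.
  by apply: (mem_flag face_lexx fP) => y _; rewrite fbot_min.
have topP : ftop \in Phi.
  by apply: (mem_flag face_lexx fP) => y _; rewrite ftop_max orbT.
have fb0 : fdim fbot = 0.
  rewrite fdim_simplex ?cards0 //.
  by have [A AF] := pm_facet pm; apply/simplexP; exists A; rewrite ?sub0set.
have [a [aP ak amax]] : exists a, [/\ a \in Phi, fdim a <= k &
    forall b, b \in Phi -> fdim b <= k -> fdim b <= fdim a].
  case: (@arg_maxnP _ fbot (fun a => (a \in Phi) && (fdim a <= k)) fdim).
    by rewrite botP fb0.
  by move=> a /andP[aP ak] h; exists a; split=> // b bP bk; apply: h; rewrite bP.
exists a => //; apply/eqP; rewrite eqn_leq ak leqNgt; apply/negP => lok.
have dtop := fdim_top.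
have [kT|kT] := eqVneq k d.+1.
  by have := amax _ topP; rewrite dtop kT leqnn => /(_ isT); lia.
have [b [bP bk bmin]] : exists b, [/\ b \in Phi, k < fdim b &
    forall e, e \in Phi -> k < fdim e -> fdim b <= fdim e].
  case: (@arg_minnP _ ftop (fun a => (a \in Phi) && (k < fdim a)) fdim).
    by rewrite topP dtop; lia.
  by move=> e /andP[eP ek] h; exists e; split=> // z zP zk; apply: h; rewrite zP.
have ab : face_le a b by apply: (chain_dim_le ch) => //; lia.
have sa : simplex F (val a).
  by rewrite simplex_neqT; apply: contraTneq lok => ->; rewrite fdim_top; lia.
(* [B] supplies the vertex to add: it is [b] itself, or a facet containing [a] when [b] is the top
   face. *)
have [B sB [aB Bb cB]] : exists2 B, simplex F B &
    [/\ val a \subset B, B \subset val b & k <= #|B|].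
  have [bT|nbT] := eqVneq b ftop; last first.
    have sb : simplex F (val b) by rewrite simplex_neqT.
    by exists (val b) => //; split=> //; rewrite -fdim_simplex // ltnW.
  case/simplexP: sa => B BF aB; exists B; first exact: facet_simplex.
  by rewrite bT subsetT (pm_card pm BF); split=> //; lia.
have [x xB xa] : exists2 x, x \in B & x \notin val a.
  apply/subsetPn; apply: contraTN cB => /subset_leq_card.
  by rewrite -fdim_simplex //; lia.
have sx : simplex F (x |: val a) by apply: simplex_sub sB; rewrite subUset sub1set xB.
pose e := face_of_simplex sx.
have de : fdim e = (fdim a).+1.
  by rewrite !fdim_simplex //= cardsU1 xa.
have ae : face_le a e by rewrite /face_le subsetUr.
have eb : face_le e b.
  by apply: subset_trans Bb; rewrite subUset sub1set xB.
have eP : e \in Phi.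
  apply: (mem_flag face_lexx fP) => y yP; have [yk|yk] := leqP (fdim y) k.
    rewrite orbC; apply/orP; left; apply: subset_trans ae.
    by apply: (chain_dim_le ch) => //; exact: amax.
  apply/orP; left; apply: subset_trans eb _.
  by apply: (chain_dim_le ch) => //; exact: bmin.
by have := amax _ eP; rewrite de => /(_ lok); rewrite ltnn.
Qed.

Lemma flag_dim_le Phi k : is_flag face_le Phi -> k <= d.+1 ->
  #|[set a in Phi | fdim a <= k]| = k.+1.
Proof.
move=> fP kd; have inj := chain_dim_inj (flag_chain fP).
pose g a : 'I_k.+1 := inord (fdim a).
have gi : {in [set a in Phi | fdim a <= k] &, injective g}.
  move=> a b; rewrite !inE => /andP[aP ak] /andP[bP bk] /(congr1 (@nat_of_ord _)).
  by rewrite !inordK ?ltnS //; exact: inj.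
rewrite -(card_in_imset gi).
have -> : g @: [set a in Phi | fdim a <= k] = setT.
  apply/setP => i; rewrite in_setT; apply/imsetP.
  have ik : i <= k by rewrite -ltnS.
  have [a aP ai] := flag_dim fP (leq_trans ik kd).
  exists a; first by rewrite inE aP ai.
  by apply/val_inj; rewrite /= inordK ai.
by rewrite cardsT card_ord.
Qed.

Lemma flag_face_card Phi : is_flag face_le Phi -> #|Phi| = d + 2.
Proof.
move=> fP; rewrite addn2 -(flag_dim_le fP (leqnn _)); apply: eq_card => a.
by rewrite inE fdim_leq andbT.
Qed.

Lemma rk_face a : rk face_le a = (fdim a).+1.
Proof.
have : is_chain face_le [set a] by apply/chainP => x y /set1P -> /set1P ->; rewrite face_lexx.
case/chain_sub_flag => Phi fP; rewrite sub1set => aP.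
rewrite (rk_flag flag_face_card face_le_po fP aP) -(flag_dim_le fP (fdim_leq a)).
apply: eq_card => b; rewrite !inE; have [bP|//] := boolP (b \in Phi).
apply/idP/idP; first exact: face_le_dim.
exact: (chain_dim_le (flag_chain fP)).
Qed.

(** Below a simplex [b], the faces in between add to [a] one of the two vertices of [b] outside [a].
    Below the top face, [a] is a ridge and the faces in between are the two facets through it. *)
Lemma face_diamond : diamond_condition face_le.
Proof.
move=> a b /andP[nab ab]; rewrite !rk_face addn2 => -[] e.
have sa : simplex F (val a).
  rewrite simplex_neqT; apply: contra nab => /eqP aT; apply/eqP.
  by apply: face_le_dim_eq ab _; rewrite aT fdim_top fdim_leq.
have lt_dim x y : Defs.ltP face_le x y = face_le x y && (fdim x < fdim y).
  rewrite /Defs.ltP; apply/andP/andP => -[]; last first.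
    by move=> xy; case: eqVneq => // ->; rewrite ltnn.
  move=> nxy xy; split=> //; rewrite ltnNge; apply: contra nxy => h.
  by rewrite (face_le_dim_eq xy h).
have btw x : Defs.ltP face_le a x && Defs.ltP face_le x b =
    [&& face_le a x, face_le x b & fdim x == (fdim a).+1].
  rewrite !lt_dim; case: (face_le a x); case: (face_le x b); rewrite ?andbF //=.
  by rewrite e; lia.
have [bT|nbT] := eqVneq b ftop; last first.
  have sb : simplex F (val b) by rewrite simplex_neqT.
  have cD : #|val b :\: val a| = 2.
    by rewrite cardsD (setIidPr ab) -!fdim_simplex // e -addn2 addKn.
  (* The default [fbot] is never reached, as [h] is used only on vertices of [b]. *)
  pose h x : face := insubd fbot (x |: val a).
  have hE x : x \in val b -> val (h x) = x |: val a.
    move=> xb; apply: insubdK; apply/orP; right; apply: simplex_sub sb.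
    by rewrite subUset sub1set xb.
  rewrite -cD -(card_in_imset (f := h)); last first.
    move=> x y /setDP[xb xa] /setDP[yb ya] /(congr1 val).
    rewrite !hE // => /setP/(_ x); rewrite !inE eqxx (negbTE xa) !orbF.
    by move/esym/eqP.
  apply: eq_card => x; rewrite inE btw; apply/and3P/imsetP.
    case=> ax xb /eqP dx.
    have sx := simplex_sub xb sb.
    have /eqP/cards1P[z ez] : #|val x :\: val a| = 1.
      by rewrite cardsD (setIidPr ax) -!fdim_simplex // dx subSnn.
    have /setDP[zx za] : z \in val x :\: val a by rewrite ez set11.
    exists z; first by rewrite inE za (subsetP xb).
    apply/val_inj; rewrite hE ?(subsetP xb) // -ez setUC setDE setUIr.
    by rewrite setUCr setIT; apply/esym/setUidPr.
  case=> z /setDP[zb za] ->.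
  have sz : simplex F (val (h z)) by rewrite hE //; apply: simplex_sub sb; rewrite subUset sub1set zb.
  rewrite /face_le !fdim_simplex // hE // cardsU1 za subsetUr subUset sub1set zb.
  by split.
have ca : #|val a| = d.-1.
  by move: e; rewrite bT fdim_top fdim_simplex // => -[->].
case/simplexP: (sa) => A AF aA.
rewrite -(pm_ridge pm AF aA ca) -(card_imset _ val_inj).
apply: eq_card => B; rewrite inE; apply/imsetP/andP.
  case=> x; rewrite inE btw bT ftop_max /= => /andP[ax /eqP dx] ->; split=> //.
  have sx : simplex F (val x).
    rewrite simplex_neqT; apply/eqP => xT; move: dx.
    by rewrite xT fdim_top fdim_simplex // ca; lia.
  by apply: (simplex_facet pm) => //; rewrite -fdim_simplex // dx fdim_simplex // ca; lia.
case=> BF aB; exists (face_of_simplex (facet_simplex BF)) => //.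
rewrite inE btw bT ftop_max /face_le aB !fdim_simplex ?(facet_simplex BF) //=.
by rewrite (pm_card pm BF) ca; lia.
Qed.

Lemma flag_exchange Theta x y : is_flag face_le Theta -> x \in Theta ->
  y \notin Theta -> {in Theta :\ x, forall z, face_le y z || face_le z y} ->
  is_flag face_le (y |: Theta :\ x) /\
  adjacent_flags Theta (y |: Theta :\ x).
Proof.
move=> fT xT yT h; split.
  apply: (chain_flag_card flag_face_card).
    apply: chainU1 => //; first exact: face_lexx.
    exact: sub_chain (subsetDl _ _) (flag_chain fT).
  rewrite cardsU1 !inE (negbTE yT) andbF /= -(flag_face_card fT).
  by rewrite [RHS](cardsD1 x) xT.
rewrite /adjacent_flags (_ : _ :\: _ = [set x]) ?cards1 //.
apply/setP => z; rewrite !inE; case: (eqVneq z x) => [->|] /=.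
  by rewrite xT andbT orbF; apply: contraNneq yT => <-.
by case: (z \in Theta); rewrite ?andbF // orbT.
Qed.

Definition flag_nbr c Phi Psi := [&& is_flag face_le Phi, is_flag face_le Psi,
  c \subset Phi, c \subset Psi & adjacent_flags Phi Psi].

Lemma flag_nbrW c c' Phi Psi : c \subset c' ->
  connect (flag_nbr c') Phi Psi -> connect (flag_nbr c) Phi Psi.
Proof.
move=> cc'; apply: connect_sub => A B /and5P[fA fB cA cB AB].
by apply: connect1; rewrite /flag_nbr fA fB AB !(subset_trans cc').
Qed.

Lemma flag_top Phi : is_flag face_le Phi -> ftop \in Phi.
Proof. by move=> fP; apply: (mem_flag face_lexx fP) => y _; rewrite ftop_max orbT. Qed.

(** The elementary move of [flag_connect]: in a flag through [lo], [x], [hi] and [c], every other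
    face lies below [lo] or above [hi], so [x] can be exchanged for any [y] between them. *)
Lemma flag_swap c lo x y hi k :
  is_chain face_le (lo |: (hi |: (x |: c))) ->
  fdim lo = k -> fdim x = k.+1 -> fdim y = k.+1 -> fdim hi = k.+2 ->
  {in c, forall z, fdim z != k.+1} -> face_le lo y -> face_le y hi ->
  exists Theta Theta', [/\ is_flag face_le Theta, is_flag face_le Theta',
    x |: c \subset Theta, y |: c \subset Theta' &
    connect (flag_nbr c) Theta Theta'].
Proof.
move=> ch dlo dx dy dhi ck loy yhi.
have [Theta fT] := chain_sub_flag ch.
rewrite !subUset !sub1set => /and4P[loT hT xT cT].
have chT := flag_chain fT.
have [<-|xy] := eqVneq x y.
  by exists Theta, Theta; split; rewrite ?subUset ?sub1set ?xT ?cT.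
have yT : y \notin Theta.
  by apply: contra xy => yT; apply/eqP/(chain_dim_inj chT) => //; rewrite dx dy.
have [|fT' adj] := flag_exchange fT xT yT.
  move=> z /setD1P[zx zT].
  have dz : fdim z != k.+1.
    by apply: contra zx => /eqP dz; apply/eqP/(chain_dim_inj chT) => //; rewrite dx dz.
  have [zk|zk] := leqP (fdim z) k.
    apply/orP; right; apply: subset_trans loy.
    by apply: (chain_dim_le chT) => //; rewrite dlo.
  apply/orP; left; apply: subset_trans yhi _.
  by apply: (chain_dim_le chT) => //; rewrite dhi ltn_neqAle eq_sym dz.
have cT' : c \subset y |: Theta :\ x.
  apply/subsetP => z zc; rewrite !inE (subsetP cT) // andbT.
  by rewrite orbC; apply/orP; left; apply: contraNneq (ck _ zc) => ->; apply/eqP.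
exists Theta, (y |: Theta :\ x); split=> //; rewrite ?subUset ?sub1set ?setU11 ?xT //.
by apply: connect1; apply/and5P.
Qed.

(** Induction on the number of faces missing from [c]. One level missing from [c] is chosen; the
    faces of [Phi] and [Psi] there are joined by moves of [flag_swap], and between the moves the
    flags share one more face, so the induction hypothesis applies. *)
Lemma flag_connect c Phi Psi :
  is_flag face_le Phi -> is_flag face_le Psi -> c \subset Phi -> c \subset Psi ->
  fbot \in c -> ftop \in c -> connect (flag_nbr c) Phi Psi.
Proof.
have [n] := ubnP (d + 2 - #|c|); elim: n => // n IH in c Phi Psi * => cn fP fS cP cS bc tc.
have chP := flag_chain fP; have chS := flag_chain fS.
have dtop := fdim_top.
(* flags sharing one more face than [c] are connected by induction *)
have IHx x (A B : {set face}) : x \notin c -> is_flag face_le A -> is_flag face_le B ->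
    x |: c \subset A -> x |: c \subset B -> connect (flag_nbr c) A B.
  move=> xc fA fB cA cB; apply: (@flag_nbrW c (x |: c)); first exact: subsetUr.
  apply: IH => //; rewrite ?setU1r //.
  have := subset_leq_card cA; rewrite (flag_face_card fA) cardsU1 xc.
  by move: cn; clear; case: n; lia.
have ltn_simplex z : fdim z <= d -> simplex F (val z).
  by rewrite simplex_neqT; apply: contraTneq => ->; rewrite dtop ltnn.
(* If [c] contains no facet, the level of facets is treated, using [pm_connect]. Otherwise
   everything happens inside one simplex [A], where unions of faces are available. *)
have [/exists_inP[A Ac /eqP dA]|] := boolP [exists A in c, fdim A == d]; last first.
  rewrite negb_exists_in => /forall_inP noF.
  have [x xP dx] := flag_dim fP (leqnSn d).
  have [y yS dy] := flag_dim fS (leqnSn d).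
  have sx := ltn_simplex x; have sy := ltn_simplex y.
  rewrite dx dy leqnn in sx sy.
  have xF : val x \in F by apply: (simplex_facet pm); rewrite -?fdim_simplex ?sx.
  have yF : val y \in F by apply: (simplex_facet pm); rewrite -?fdim_simplex ?sy.
  have fb0 : fdim fbot = 0 by rewrite fdim_simplex ?cards0 // (simplex_sub (sub0set (val x))) ?sx.
  have cdim z : z \in c -> z != ftop -> fdim z <= d.-1.
    move=> zc zT; have := noF _ zc; have := fdim_simplex.
    rewrite -simplex_neqT in zT; move/(_ _ zT) => e.
    have := simplex_card pm zT; rewrite -e; move: (fdim z) d2; clear; lia.
  (* [f] is the largest face of [c] below the top; the walk from [x] to [y] takes place in its
     star. *)
  have [f [fc nf fmax]] : exists f, [/\ f \in c, f != ftop &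
      forall z, z \in c -> z != ftop -> face_le z f].
    case: (@arg_maxnP _ fbot (fun a => (a \in c) && (a != ftop)) fdim).
      by rewrite bc -simplex_neqT ltn_simplex // fb0.
    move=> a /andP[ac aT] h; exists a; split=> // z zc zT.
    apply: (chain_dim_le chP); rewrite ?(subsetP cP) //.
    by apply: h; rewrite zc.
  have fx : val f \subset val x.
    by apply: (chain_dim_le chP (subsetP cP _ fc) xP); rewrite dx (leq_trans (cdim _ fc nf)) ?leq_pred.
  have fy : val f \subset val y.
    by apply: (chain_dim_le chS (subsetP cS _ fc) yS); rewrite dy (leq_trans (cdim _ fc nf)) ?leq_pred.
  have nc z : fdim z = d -> z \notin c by move=> dz; apply/negP => /noF; rewrite dz eqxx.
  have /connectP[p] := pm_connect pm xF yF fx fy.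
  elim: p => [|C p IHp] in x Phi fP cP chP xP dx xF fx {sx} *.
    move=> _; rewrite [last _ _]/= => /val_inj e; apply: (IHx x); rewrite ?nc //.
      by rewrite subUset sub1set xP.
    by rewrite subUset sub1set -e yS.
  case/andP=> nxC pC lC.
  have [/and5P[_ CF _ fC _] xC] := (nxC, nbr_cap pm nxC).
  have [c' vc'] : exists c' : face, val c' = C by exists (face_of_simplex (facet_simplex CF)).
  have dc' : fdim c' = d by rewrite fdim_simplex vc' ?facet_simplex // (pm_card pm CF).
  have sD : simplex F (val x :&: C).
    by apply: simplex_sub (facet_simplex CF); exact: subsetIr.
  have [e|/xC cxC] := eqVneq (val x) C.
    by apply: (IHp x) => //; rewrite ?e.
  (* [D] is the ridge between consecutive facets of the walk. It contains [f], hence every face of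
     [c] except the top, so it can be added to the chain. *)
  have [D vD] : exists D : face, val D = val x :&: C by exists (face_of_simplex sD).
  have DE : fdim D = d.-1 by rewrite fdim_simplex vD.
  have ch : is_chain face_le (D |: (ftop |: (x |: c))).
    have chx : is_chain face_le (ftop |: (x |: c)).
      by apply: sub_chain (flag_chain fP); rewrite !subUset !sub1set xP cP (flag_top fP).
    apply: chainU1 => //; first exact: face_lexx.
    move=> z /setU1P[->|/setU1P[->|zc]].
    - by rewrite ftop_max.
    - by rewrite /face_le vD subsetIl.
    - have [->|zT] := eqVneq z ftop; first by rewrite ftop_max.
      rewrite orbC /face_le vD subsetI (subset_trans (fmax _ zc zT) fx).
      by rewrite (subset_trans (fmax _ zc zT) fC).
  have dk : d.-1.+1 = d by rewrite prednK // ltnW.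
  have ck : {in c, forall z, fdim z != d.-1.+1} by move=> z; rewrite dk; exact: noF.
  have Dc' : face_le D c' by rewrite /face_le vD vc' subsetIr.
  have dtop' : fdim ftop = d.-1.+2 by rewrite dk.
  have [Th [Th' [fT fT' cT cT' TT']]] := flag_swap ch DE
    (etrans dx (esym dk)) (etrans dc' (esym dk)) dtop' ck Dc' (ftop_max _).
  apply: (connect_trans (y := Th)).
    by apply: (IHx x); rewrite ?nc // subUset sub1set xP.
  apply: connect_trans TT' _; move: cT'; rewrite subUset sub1set => /andP[cT1 cT2].
  by apply: (IHp c'); rewrite ?vc' //; exact: flag_chain.
(* If [c] already meets every level, both flags equal [c]. *)
have [/forallP full|] := boolP [forall i : 'I_d.+2, [exists z in c, fdim z == i]].
  have allc Om z : is_flag face_le Om -> c \subset Om -> z \in Om -> z \in c.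
    move=> fO cO zO; have zd : fdim z < d.+2 by rewrite ltnS fdim_leq.
    have /exists_inP[w wc /eqP /= e] := full (Ordinal zd).
    by rewrite (chain_dim_inj (flag_chain fO) _ _ (esym e)) // (subsetP cO).
  have -> : Phi = c by apply/eqP; rewrite eqEsubset cP andbT; apply/subsetP => z; exact: allc.
  have -> : Psi = c by apply/eqP; rewrite eqEsubset cS andbT; apply/subsetP => z; exact: allc.
  exact: connect0.
rewrite negb_forall => /existsP[i0 i0P].
have exk : exists k, [forall z in c, fdim z != k].
  by exists (nat_of_ord i0); rewrite -negb_exists_in.
(* The smallest missing level is taken so that the level just below it has a face [lo] in [c],
   common to both flags. *)
case: (ex_minnP exk) => m /forall_inP mP mmin.
have md : m <= d.
  have := mmin (nat_of_ord i0); rewrite -negb_exists_in => /(_ i0P) mi.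
  have := mP _ tc; rewrite dtop; have := ltn_ord i0; move: mi; clear; lia.
have mdA : m < d by have := mP _ Ac; rewrite dA; move: md; clear; lia.
have sA : simplex F (val A) by rewrite ltn_simplex // dA.
have fb0 : fdim fbot = 0 by rewrite fdim_simplex ?cards0 // (simplex_sub (sub0set (val A))).
have m0 : 0 < m by have := mP _ bc; rewrite fb0; clear; lia.
case: m m0 md mdA mP mmin => // k _ md mdA mP mmin.
have [lo loc dlo] : exists2 lo, lo \in c & fdim lo = k.
  have : ~~ [forall z in c, fdim z != k] by apply/negP => /mmin; rewrite ltnn.
  by rewrite negb_forall_in => /exists_inP[lo loc]; rewrite negbK => /eqP; exists lo.
have [x xP dx] := flag_dim fP (leqW md).
have [y yS dy] := flag_dim fS (leqW md).
have xc : x \notin c by apply/negP => /mP; rewrite dx eqxx.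
have yc : y \notin c by apply/negP => /mP; rewrite dy eqxx.
have cx : x |: c \subset Phi by rewrite subUset sub1set xP.
have cy : y |: c \subset Psi by rewrite subUset sub1set yS.
have [e|xy] := eqVneq x y; first by apply: (IHx x); rewrite // e.
have leP z w : z \in Phi -> w \in Phi -> fdim z <= fdim w -> face_le z w by exact: chain_dim_le.
have leS z w : z \in Psi -> w \in Psi -> fdim z <= fdim w -> face_le z w by exact: chain_dim_le.
have inP := subsetP cP; have inS := subsetP cS.
have lox : face_le lo x by apply: (leP _ _ (inP _ loc) xP); rewrite dlo dx.
have loy : face_le lo y by apply: (leS _ _ (inS _ loc) yS); rewrite dlo dy.
have xA : face_le x A by apply: (leP _ _ xP (inP _ Ac)); rewrite dA dx ltnW.
have yA : face_le y A by apply: (leS _ _ yS (inS _ Ac)); rewrite dA dy ltnW.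
have sH : simplex F (val x :|: val y) by apply: simplex_sub sA; rewrite subUset; apply/andP.
have [hi vhi] : exists hi : face, val hi = val x :|: val y by exists (face_of_simplex sH).
have sx := simplex_sub xA sA; have sy := simplex_sub yA sA; have slo := simplex_sub lox sx.
have dhi : fdim hi = k.+2.
  (* Two distinct faces that each add one vertex to [lo] meet exactly in [lo], so their union lies
     one level higher. *)
  have capE : val x :&: val y = val lo.
    apply/eqP; rewrite eq_sym eqEcard subsetI [val lo \subset val x]lox [val lo \subset val y]loy /= leqNgt -(fdim_simplex slo) dlo.
    apply: contra xy => h; apply/eqP/val_inj/eqP.
    have -> : val x = val x :&: val y.
      by apply/eqP; rewrite eq_sym eqEcard subsetIl -(fdim_simplex sx) dx.
    by rewrite eqEcard subsetIr -(fdim_simplex sy) dy.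
  rewrite fdim_simplex vhi // cardsU capE -!fdim_simplex // dlo dx dy; clear; lia.
have ch : is_chain face_le (lo |: (hi |: (x |: c))).
  have chx : is_chain face_le (x |: c) by apply: sub_chain cx chP.
  rewrite setUCA (_ : lo |: (x |: c) = x |: c); last first.
    by apply/setUidPr; rewrite sub1set !inE loc orbT.
  apply: chainU1 => //; first exact: face_lexx.
  move=> z /setU1P[->|zc]; first by rewrite /face_le vhi subsetUl orbT.
  have [zk|zk] := leqP (fdim z) k.
    apply/orP; right; rewrite /face_le vhi; apply: subset_trans (subsetUl _ _).
    by apply: subset_trans lox; apply: (leP _ _ (inP _ zc) (inP _ loc)); rewrite dlo.
  apply/orP; left; rewrite /face_le vhi subUset; apply/andP; split.
    by apply: (leP _ _ xP (inP _ zc)); rewrite dx.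
  by apply: (leS _ _ yS (inS _ zc)); rewrite dy.
have yhi : face_le y hi by rewrite /face_le vhi subsetUr.
have [Th [Th' [fT fT' cT cT' TT']]] := flag_swap ch dlo dx dy dhi mP loy yhi.
apply: (connect_trans (y := Th)); first exact: (IHx x).
by apply: connect_trans TT' _; exact: (IHx y).
Qed.

Lemma face_strongly_connected : strongly_flag_connected face_le.
Proof.
move=> Phi Psi fP fS.
have botP Om : is_flag face_le Om -> fbot \in Om.
  by move=> fO; apply: (mem_flag face_lexx fO) => y _; rewrite fbot_min.
have : connect (flag_nbr (Phi :&: Psi)) Phi Psi.
  by apply: flag_connect; rewrite ?subsetIl ?subsetIr ?inE ?flag_top ?botP.
move: (Phi :&: Psi) => c /connectP[p pp ->]; exists p.
elim: p Phi {fP} pp => //= A p IH Phi /andP[/and5P[_ fA _ cA adj] pp].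
by have [h1 h2 _ h4] := IH _ pp; rewrite fA adj cA h1 h2 h4.
Qed.

Lemma face_polytope : abstract_polytope face_le d.
Proof.
split.
- exact: face_le_po.
- by exists fbot; exact: fbot_min.
- by exists ftop; exact: ftop_max.
- exact: flag_face_card.
- by split; [exact: face_diamond | exact: face_strongly_connected].
Qed.

Lemma proper_face_simplex a :
  proper_face face_le a = (val a != set0) && simplex F (val a).
Proof.
rewrite (proper_faceE a face_le_po fbot_min ftop_max) -simplex_neqT.
by rewrite -(inj_eq val_inj).
Qed.

End FacePoset.

(** * Automorphisms of the face poset are the simplicial automorphisms *)

Section FaceAutomorphisms.
Variables (V : finType) (d : nat) (F : {set {set V}}).
Hypothesis d2 : 2 <= d.
Hypothesis pm : pseudomanifold d F.
Local Notation face := (face F).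
Local Notation face_le := (@face_le V F).
Local Notation fbot := (fbot pm).
Local Notation ftop := (ftop F).
Implicit Types (a b : face) (v w : V) (f : V -> V).

Lemma simplex1 v : simplex F [set v].
Proof.
have [A AF vA] := pm_cover pm v.
by apply/simplexP; exists A; rewrite // sub1set.
Qed.

Definition vertex v : face := face_of_simplex (simplex1 v).

Lemma vertex_le v a : face_le (vertex v) a = (v \in val a).
Proof. exact: sub1set. Qed.

Lemma vertex_inj : injective vertex.
Proof. by move=> v w /(congr1 val) /= /set1_inj. Qed.

(** Vertices described by the order alone, so that order automorphisms visibly permute them. *)
Definition is_atom a := a <> fbot /\ forall b, face_le b a -> b = fbot \/ b = a.

Lemma atomP a : is_atom a <-> exists v, a = vertex v.
Proof.
split=> [[a0 h]|[v ->]].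
  have [v va] : exists v, v \in val a.
    by apply/set0Pn; apply: contra_not_neq a0 => a0; exact: val_inj.
  have [/(congr1 val) /= e|<-] := h (vertex v) ltac:(by rewrite vertex_le).
    by have := set11 v; rewrite e inE.
  by exists v.
split=> [/(congr1 val) /= e|b]; first by have := set11 v; rewrite e inE.
by rewrite /face_le subset1 => /orP[] /eqP e; [right|left]; exact: val_inj.
Qed.

Section FromPerm.
Variable s : {perm face}.
Hypothesis sP : forall a b, face_le (s a) (s b) = face_le a b.

Lemma perm_le_inv a b : face_le ((s^-1)%g a) b = face_le a (s b).
Proof. by rewrite -sP permKV. Qed.

Lemma perm_bot : s fbot = fbot.
Proof.
have [_ anti _] := face_le_po F.
by apply: anti; rewrite fbot_min andbT -[X in face_le _ X](permKV s) sP fbot_min.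
Qed.

Lemma perm_top : s ftop = ftop.
Proof.
have [_ anti _] := face_le_po F.
by apply: anti; rewrite ftop_max /= -perm_le_inv ftop_max.
Qed.

Lemma perm_atom a : is_atom a -> is_atom (s a).
Proof.
case=> a0 h; split=> [e|b].
  by apply: a0; apply: (@perm_inj _ s); rewrite perm_bot.
rewrite -{1}(permKV s b) sP => /h[] e; [left|right].
  by rewrite -(permKV s b) e perm_bot.
by rewrite -e permKV.
Qed.
End FromPerm.

(** An order automorphism permutes the atoms, and a face is determined by the atoms below it. *)
Lemma aut_face_simplicial (s : {perm face}) :
  (forall a b, face_le (s a) (s b) = face_le a b) ->
  exists2 f, simplicial_aut F f & forall a, val (s a) = f @: val a.
Proof.
move=> sP.
have sP' a b : face_le ((s^-1)%g a) ((s^-1)%g b) = face_le a b.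
  by rewrite -sP !permKV.
have /fin_all_exists[f fE] : forall v, exists w, s (vertex v) = vertex w.
  by move=> v; apply/atomP/perm_atom => //; apply/atomP; exists v.
have fin : injective f.
  by move=> v w e; apply/vertex_inj/(@perm_inj _ s); rewrite !fE e.
have fs a : val (s a) = f @: val a.
  apply/setP => w; apply/idP/imsetP => [wa|[v va ->]]; last first.
    by rewrite -vertex_le -fE sP vertex_le.
  have [v ev] : exists v, (s^-1)%g (vertex w) = vertex v.
    by apply/atomP/perm_atom => //; apply/atomP; exists w.
  exists v; first by rewrite -vertex_le -ev perm_le_inv // vertex_le.
  by apply: vertex_inj; rewrite -fE -ev permKV.
exists f => //; split=> // A AF.
pose a := face_of_simplex (facet_simplex AF).
have aT : a != ftop by rewrite -(simplex_neqT d2 pm) facet_simplex.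
have : simplex F (val (s a)).
  by rewrite (simplex_neqT d2 pm) -(perm_top sP) (inj_eq perm_inj).
by rewrite fs => /(simplex_facet pm); apply; rewrite card_imset // (pm_card pm AF).
Qed.

Definition face_map f a : face := insubd ftop (f @: val a).

Lemma face_mapE f a : simplicial_aut F f -> val (face_map f a) = f @: val a.
Proof.
move=> [fi fF]; apply: insubdK; case: (facePT a) => [->|/simplexP[B BF aB]].
  apply/orP; left; rewrite -subTset; apply/subsetP => v _.
  by have [g _ fg] := injF_bij fi; rewrite -(fg v) imset_f.
apply/orP; right; apply/simplexP; exists (f @: B); first exact: fF.
exact: imsetS.
Qed.

Lemma face_map_inj f : simplicial_aut F f -> injective (face_map f).
Proof.
move=> fA a b /(congr1 val); rewrite !face_mapE // => /imset_inj e.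
by apply/val_inj/e; case: fA.
Qed.

(** Made total, with the identity as fallback, so that [rho g] yields a permutation for every [g] in
    the type [gT], inside [G] or not. *)
Definition face_perm f : {perm face} :=
  if @idP (injectiveb (face_map f)) is ReflectT h
  then perm (elimT (injectiveP _) h) else 1%g.

Lemma face_permE f a : simplicial_aut F f -> val (face_perm f a) = f @: val a.
Proof.
move=> fA; rewrite /face_perm; case: {-}_ / idP => [h|h].
  by rewrite permE face_mapE.
by case: h; apply/injectiveP/face_map_inj.
Qed.

(** The order of composition asked of [rho] is that of [permM], which makes
    [g |-> face_perm (rho g)] a morphism. Its action on vertices gives injectivity, and
    [aut_face_simplicial] gives surjectivity. *)
Lemma aut_face_isog (gT : finGroupType) (G : {group gT}) (rho : gT -> V -> V) :
  {in G, forall g, simplicial_aut F (rho g)} ->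
  {in G &, forall g h v, rho (g * h)%g v = rho h (rho g v)} ->
  {in G, forall g, rho g =1 id -> g = 1%g} ->
  (forall f, simplicial_aut F f -> exists2 g, g \in G & f =1 rho g) ->
  isog (Aut_poset face_le) G.
Proof.
move=> rA rM r1 rS.
pose phi g := face_perm (rho g).
have phiM : {in G &, {morph phi : g h / (g * h)%g}}.
  move=> g h gG hG; apply/permP => a; apply: val_inj.
  rewrite permM (face_permE _ (rA _ (groupM gG hG))).
  rewrite (face_permE _ (rA _ hG)) (face_permE _ (rA _ gG)) -imset_comp.
  by apply: eq_imset => v /=; rewrite rM.
pose Phi := Morphism phiM.
have injPhi : ('injm Phi)%g.
  apply/subsetP => g /morphpreP[gG /set1P e]; apply/set1P/r1 => // v.
  have := face_permE (vertex v) (rA g gG); rewrite -/(phi g) -[phi g]/(Phi g) e perm1 /=.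
  by rewrite imset_set1 => /set1_inj.
have -> : Aut_poset face_le = (Phi @* G)%g.
  apply/setP => s; rewrite inE morphimEdom; apply/idP/imsetP.
    move=> /forallP h; have sP a b : face_le (s a) (s b) = face_le a b.
      by have /forallP/(_ b)/eqP := h a.
    have [f fA fE] := aut_face_simplicial sP.
    have [g gG fg] := rS f fA; exists g => //.
    apply/permP => a; apply: val_inj; apply: etrans (fE a) _.
    by apply: etrans _ (esym (face_permE a (rA g gG))); apply: eq_imset.
  case=> g gG ->; apply/forallP => a; apply/forallP => b.
  rewrite /face_le !(face_permE _ (rA g gG)); apply/eqP.
  have [ri _] := rA g gG.
  apply/idP/idP => [/subsetP h|]; last exact: imsetS.
  by apply/subsetP => v va; rewrite -(mem_imset _ _ ri) h // imset_f.
by rewrite isog_sym; exact: sub_isog.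
Qed.

End FaceAutomorphisms.

(** * Subdividing a set of facets *)

Section Degree.
Variables (V : finType) (F : {set {set V}}).
Implicit Types (v : V) (f g : V -> V).

Definition degree v := #|[set A in F | v \in A]|.

Lemma aut_facets f : simplicial_aut F f -> [set f @: A | A : {set V} in F] = F.
Proof.
move=> [fi fF]; apply/eqP; rewrite eqEcard (card_imset _ (imset_inj fi)) leqnn andbT.
by apply/subsetP => _ /imsetP[A AF ->]; exact: fF.
Qed.

Lemma aut_degree f v : simplicial_aut F f -> degree (f v) = degree v.
Proof.
move=> fA; have [fi fF] := fA; rewrite /degree -[RHS](card_imset _ (imset_inj fi)).
apply: eq_card => B; rewrite inE; apply/andP/imsetP => [[]|[A]].
  rewrite -{1}(aut_facets fA) => /imsetP[A AF ->]; rewrite mem_imset // => vA.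
  by exists A; rewrite // inE AF.
by rewrite inE => /andP[AF vA] ->; rewrite fF ?mem_imset.
Qed.

End Degree.

Section Stack.
Variables (V : finType) (d : nat) (F M : {set {set V}}).
Local Notation M_ := {A : {set V} | A \in M}.
Implicit Types (A B s : {set V}) (v x y : V) (m : M_).

(** A new vertex carries the facet it subdivides, so its image under an automorphism can be read off
    the action on [M]. *)
Definition svert : finType := (V + M_)%type.
Implicit Types (X Y t : {set svert}).

Definition old A : {set svert} := (inl : V -> svert) @: A.
Definition trace X : {set V} := (inl : V -> svert) @^-1: X.
(** The cone from the new vertex over the ridge of [m] opposite to [x]. *)
Definition child m x : {set svert} := (inr m : svert) |: old (val m :\ x).

Definition stack : {set {set svert}} :=
  [set old A | A in F :\: M] :|: [set X | [exists m : M_, exists x in val m, X == child m x]].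

(** The facet of [F] that contains [X] geometrically. A facet of [stack] has at most one new vertex,
    so the choice made by [pick] is harmless there ([parent_inr]). *)
Definition parent X : {set V} :=
  if [pick m | (inr m : svert) \in X] is Some m then val m else trace X.

Lemma inl_inj : injective (inl : V -> svert). Proof. by move=> x y []. Qed.

Lemma mem_old v A : ((inl v : svert) \in old A) = (v \in A).
Proof. by rewrite mem_imset //; exact: inl_inj. Qed.

Lemma inr_old m A : ((inr m : svert) \in old A) = false.
Proof. by apply/negP => /imsetP[]. Qed.

Lemma mem_child v m x : ((inl v : svert) \in child m x) = (v != x) && (v \in val m).
Proof. by rewrite in_setU1 mem_old in_setD1. Qed.

Lemma inr_child m' m x : ((inr m' : svert) \in child m x) = (m' == m).
Proof. by rewrite in_setU1 inr_old orbF. Qed.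

Lemma old_sub A B : (old A \subset old B) = (A \subset B).
Proof.
apply/idP/idP => [/subsetP h|]; last exact: imsetS.
by apply/subsetP => v vA; rewrite -mem_old h // mem_old.
Qed.

Lemma old_inj : injective old. Proof. exact/imset_inj/inl_inj. Qed.

Lemma card_old A : #|old A| = #|A|. Proof. exact/card_imset/inl_inj. Qed.

Lemma old_trace X : (forall m, (inr m : svert) \notin X) -> X = old (trace X).
Proof.
move=> h; apply/setP => -[v|m]; first by rewrite mem_old inE.
by rewrite inr_old (negbTE (h m)).
Qed.

Lemma old_sub_child A m x : (old A \subset child m x) = (A \subset val m :\ x).
Proof.
rewrite -old_sub; apply/subsetP/subsetP => h [v|m'] hv.
- by have := h _ hv; rewrite mem_old mem_child in_setD1.
- by rewrite inr_old in hv.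
- by rewrite mem_child -in_setD1 -mem_old h.
- by rewrite inr_old in hv.
Qed.

Lemma child_inj m : {in val m &, injective (child m)}.
Proof.
move=> x y xm ym /setP/(_ (inl x)); rewrite !mem_child eqxx /= xm andbT.
by move/esym/negbFE/eqP.
Qed.

Lemma parent_old A : parent (old A) = A.
Proof.
rewrite /parent; case: pickP => [m|_]; first by rewrite inr_old.
by apply/setP => v; rewrite inE mem_old.
Qed.

Lemma parent_inr X m : X \in stack -> (inr m : svert) \in X -> parent X = val m.
Proof.
rewrite !inE => /orP[/imsetP[A _ ->]|/existsP[m' /exists_inP[x _ /eqP ->]]].
  by rewrite inr_old.
rewrite inr_child /parent => /eqP ->; case: pickP => [m''|/(_ m')].
  by rewrite inr_child => /eqP ->.
by rewrite inr_child eqxx.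
Qed.

Lemma old_stack A : A \in F -> A \notin M -> old A \in stack.
Proof. by move=> AF AM; rewrite inE imset_f // inE AM. Qed.

Lemma child_stack m x : x \in val m -> child m x \in stack.
Proof.
by move=> xm; rewrite !inE; apply/orP; right; apply/existsP; exists m; apply/exists_inP; exists x.
Qed.

Lemma parent_child m x : x \in val m -> parent (child m x) = val m.
Proof. by move=> xm; apply: parent_inr; rewrite ?child_stack // inr_child. Qed.

Variant stack_spec X : Prop :=
  | StackOld A of A \in F & A \notin M & X = old A
  | StackChild m x of x \in val m & X = child m x.

Lemma stackP X : X \in stack -> stack_spec X.
Proof.
rewrite !inE => /orP[/imsetP[A /setDP[AF AM] ->]|].
  exact: (@StackOld _ A).
by case/existsP => m /exists_inP[x xm /eqP ->]; exact: (@StackChild _ m x).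
Qed.

Hypothesis d3 : 3 <= d.
Hypothesis MF : M \subset F.
Hypothesis pm : pseudomanifold d F.

Lemma valMF m : val m \in F. Proof. exact: (subsetP MF _ (valP m)). Qed.

Lemma parent_facet X : X \in stack -> parent X \in F.
Proof.
case/stackP => [A AF AM ->|m x xm ->]; first by rewrite parent_old.
by rewrite parent_child // valMF.
Qed.

Lemma trace_parent X : X \in stack -> trace X \subset parent X.
Proof.
case/stackP => [A AF AM ->|m x xm ->]; apply/subsetP => v; rewrite inE.
  by rewrite parent_old mem_old.
by rewrite mem_child parent_child // => /andP[].
Qed.

Lemma old_sub_parent A X : X \in stack -> old A \subset X -> A \subset parent X.
Proof.
move=> XS /subsetP h; apply: subset_trans (trace_parent XS).
by apply/subsetP => v vA; rewrite inE h // mem_old.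
Qed.

Lemma stack_card X : X \in stack -> #|X| = d.
Proof.
case/stackP => [A AF AM ->|m x xm ->]; first by rewrite card_old (pm_card pm AF).
rewrite cardsU1 inr_old card_old -(pm_card pm (valMF m)).
by rewrite [RHS](cardsD1 x) xm.
Qed.

(** A proper subset [s] of a subdivided [A] misses some vertex [x], and the child opposite to [x]
    still contains [s]. This is why simplices with fewer than [d] vertices survive. *)
Lemma stack_lift A s : A \in F -> s \subset A -> #|s| < d ->
  exists X, [/\ X \in stack, old s \subset X & parent X = A].
Proof.
move=> AF sA cs; have [AM|AM] := boolP (A \in M); last first.
  by exists (old A); rewrite old_stack // old_sub parent_old.
have [x xA xs] : exists2 x, x \in A & x \notin s.
  apply/subsetPn; apply: contraTN cs => /subset_leq_card.
  by rewrite (pm_card pm AF) -leqNgt.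
exists (child (exist _ A AM) x); rewrite child_stack // old_sub_child parent_child //.
by split=> //; apply/subsetP => v vs; rewrite in_setD1 (subsetP sA) // andbT; apply: contraNneq xs => <-.
Qed.

Lemma stack_simplex s : simplex F s -> #|s| < d -> simplex stack (old s).
Proof.
case/simplexP => A AF sA /(stack_lift AF sA)[X [XS sX _]].
by apply/simplexP; exists X.
Qed.

(** The link of a new vertex is the boundary of the simplex [m]. *)
Lemma facets_through_new m s : s \subset val m ->
  [set X in stack | (inr m : svert) |: old s \subset X] = [set child m x | x in val m :\: s].
Proof.
move=> sm; apply/setP => X; rewrite inE subUset sub1set; apply/and3P/imsetP.
  case=> /stackP[A AF AM ->|m' x xm ->]; first by rewrite inr_old.
  rewrite inr_child old_sub_child => /eqP e sx; subst m'; exists x => //.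
  rewrite inE xm andbT; apply/negP => /(subsetP sx).
  by rewrite in_setD1 eqxx.
case=> x /setDP[xm xs] ->; rewrite child_stack // inr_child eqxx old_sub_child.
split=> //; apply/subsetP => v vs; rewrite in_setD1 (subsetP sm) // andbT.
by apply: contraNneq xs => <-.
Qed.

(** A ridge through a new vertex keeps [d - 2] vertices of [m], and the children through it omit one
    of the other two. For an old ridge, [parent] is a bijection onto the facets of [F] through it: a
    child of [m] containing an entire ridge of [m] is determined by that ridge. *)
Lemma stack_ridge X t : X \in stack -> t \subset X -> #|t| = d.-1 ->
  #|[set Y in stack | t \subset Y]| = 2.
Proof.
move=> XS tX ct; case: (pickP (fun m => (inr m : svert) \in t)) => [m mt|tm].
  have mX := subsetP tX _ mt; have pX := parent_inr XS mX.
  have et : t = (inr m : svert) |: old (trace t).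
    apply/setP => -[v|m']; first by rewrite in_setU1 mem_old inE.
    rewrite in_setU1 inr_old orbF; apply/idP/eqP => [m't|[->] //].
    congr inr; apply: val_inj.
    by rewrite -pX (parent_inr XS (subsetP tX _ m't)).
  have tm : trace t \subset val m.
    by rewrite -pX; apply: subset_trans (trace_parent XS); exact: preimsetS.
  rewrite {1}et facets_through_new // card_in_imset; last first.
    by move=> x y /setDP[xm _] /setDP[ym _]; exact: child_inj.
  rewrite cardsD (setIidPr tm) (pm_card pm (valMF m)).
  by move: ct; rewrite {1}et cardsU1 inr_old card_old; move: d3; clear; lia.
have et : t = old (trace t) by apply: old_trace => m; rewrite tm.
move: (trace t) et => s et; subst t; rewrite card_old in ct.
have sX := old_sub_parent XS tX.
have sd : #|s| < d by rewrite ct prednK // ltnW // ltnW.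
rewrite -(pm_ridge pm (parent_facet XS) sX ct) -(card_in_imset (f := parent)); last first.
  move=> Y Z /setIdP[/stackP[A AF AM ->|m x xm ->] sY] /setIdP[/stackP[B BF BM ->|m' y ym ->] sZ].
  - by rewrite !parent_old => ->.
  - by rewrite parent_old parent_child // => e; rewrite e (valP m') in AM.
  - by rewrite parent_old parent_child // => e; rewrite -e (valP m) in BM.
  - rewrite !parent_child // => /val_inj e; subst m'; congr child.
    rewrite !old_sub_child in sY sZ.
    have cD z : z \in val m -> #|val m :\ z| = d.-1.
      by move=> zm; rewrite -(pm_card pm (valMF m)) [in RHS](cardsD1 z) zm.
    have eY : s = val m :\ x by apply/eqP; rewrite eqEcard sY ct cD /=.
    have eZ : s = val m :\ y by apply/eqP; rewrite eqEcard sZ ct cD /=.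
    apply/eqP; apply: contraT => xy; have : x \in s by rewrite eZ in_setD1 xy.
    by rewrite eY in_setD1 eqxx.
apply: eq_card => A; apply/imsetP/idP => [[Y /setIdP[YS sY] ->]|].
  by rewrite inE parent_facet // (old_sub_parent YS).
rewrite inE => /andP[AF sA]; have [Y [YS sY <-]] := stack_lift AF sA sd.
by exists Y; rewrite // inE YS.
Qed.

Lemma stack_siblings t X Y : X \in stack -> Y \in stack -> parent X = parent Y ->
  t \subset X -> t \subset Y -> connect (facet_nbr stack t) X Y.
Proof.
move=> XS YS pXY tX tY; apply: connect1; apply/and5P; split=> //.
case: (stackP XS) (stackP YS) pXY => [A AF AM ->|m x xm ->] [B BF BM ->|m' y ym ->].
- by rewrite !parent_old => ->; rewrite setDv cards0.
- by rewrite parent_old parent_child // => e; rewrite e (valP m') in AM.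
- by rewrite parent_old parent_child // => e; rewrite -e (valP m) in BM.
rewrite !parent_child // => /val_inj e; subst m'.
rewrite -(cards1 (inl y : svert)); apply/subset_leq_card/subsetP => -[v|m'].
  rewrite in_setD !mem_child negb_and negbK in_set1 => /andP[/orP[/eqP-> //|vm]].
  by rewrite (negbTE vm) andbF.
by rewrite in_setD !inr_child andNb.
Qed.

(** If [t] has a new vertex, [X] and [Y] are children of one facet and thus adjacent. Otherwise a
    walk between the parents is lifted. *)
Lemma stack_connect t X Y : X \in stack -> Y \in stack -> t \subset X -> t \subset Y ->
  connect (facet_nbr stack t) X Y.
Proof.
move=> XS YS tX tY; case: (pickP (fun m => (inr m : svert) \in t)) => [m mt|tm].
  apply: stack_siblings => //.
  by rewrite !(@parent_inr _ m) ?(subsetP tX) ?(subsetP tY).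
have et : t = old (trace t) by apply: old_trace => m; rewrite tm.
move: (trace t) et => s et; subst t.
have /connectP[p] := pm_connect pm (parent_facet XS) (parent_facet YS)
  (old_sub_parent XS tX) (old_sub_parent YS tY).
elim: p => [|B p IH] in X XS tX *; first by move=> _ /= e; apply: stack_siblings.
rewrite [path _ _ _]/= [last _ _]/= => /andP[nAB pB] lB.
have [e|nAB'] := eqVneq (parent X) B; first by apply: IH; rewrite ?e.
have ct := nbr_cap pm nAB nAB'; case/and5P: nAB => AF BF sA sB _.
(* The walk crosses from [parent X] to [B] through facets [X0] and [Y0] above them that contain the
   whole common ridge; within one parent, siblings are adjacent. *)
have ltc : #|parent X :&: B| < d by rewrite ct prednK // ltnW // ltnW.
have [X0 [X0S tX0 pX0]] := stack_lift AF (subsetIl _ B) ltc.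
have [Y0 [Y0S tY0 pY0]] := stack_lift BF (subsetIr (parent X) _) ltc.
have sAB : old s \subset old (parent X :&: B) by rewrite old_sub subsetI sA.
apply: (connect_trans (y := X0)).
  by apply: stack_siblings => //; apply: subset_trans tX0.
apply: (connect_trans (y := Y0)); last first.
  by apply: IH; rewrite ?pY0 //; apply: subset_trans tY0.
apply: connect1; apply/and5P; split=> //; try exact: subset_trans _ _.
- exact: subset_trans tX0.
- exact: subset_trans tY0.
have : old (parent X :&: B) \subset X0 :&: Y0 by rewrite subsetI tX0.
move/subset_leq_card; rewrite card_old ct cardsD (stack_card X0S).
by move: d3; clear; lia.
Qed.

Lemma stack_pseudomanifold : pseudomanifold d stack.
Proof.
split.
- move=> [v|m].
    have [A AF vA] := pm_cover pm v.
    have [||X [XS vX _]] := stack_lift (s := [set v]) AF; rewrite ?sub1set ?cards1 ?(ltnW d3) //.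
    by exists X => //; apply: (subsetP vX); rewrite mem_old set11.
  have [x xm] : exists x, x \in val m.
    by apply/card_gt0P; rewrite (pm_card pm (valMF m)); move: d3; clear; lia.
  by exists (child m x); rewrite ?child_stack // inr_child.
- have [A AF] := pm_facet pm.
  have [||X [XS _ _]] := stack_lift (s := set0) AF; rewrite ?sub0set ?cards0 //.
    by move: d3; clear; lia.
  by exists X.
- exact: stack_card.
- exact: stack_ridge.
- exact: stack_connect.
Qed.

Lemma degree_new m : degree stack (inr m : svert) = d.
Proof.
rewrite -(pm_card pm (valMF m)) -[val m in RHS]setD0 /degree.
have <- : #|child m @: (val m :\: set0)| = #|val m :\: set0|.
  by rewrite setD0; exact/card_in_imset/child_inj.
rewrite -facets_through_new ?sub0set //; apply: eq_card => X.
by rewrite !inE /old imset0 setU0 sub1set.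
Qed.

(** [parent] maps the facets through [v] in the stack onto those in [F]. If [v] lies in a subdivided
    facet, at least two of its children contain [v], so the map is not injective and the degree
    grows. *)
Lemma degree_old v : degree F v + (v \in cover M) <= degree stack (inl v : svert).
Proof.
pose S := [set X in stack | (inl v : svert) \in X].
have d1 : #|[set v]| < d by rewrite cards1 ltnW.
have im : parent @: S = [set A in F | v \in A].
  apply/setP => A; rewrite inE; apply/imsetP/andP => [[X]|[AF vA]].
    rewrite inE => /andP[XS vX] ->; rewrite parent_facet //; split=> //.
    by apply: (subsetP (trace_parent XS)); rewrite inE.
  have [|X [XS vX <-]] := stack_lift AF _ d1; first by rewrite sub1set.
  by exists X; rewrite // inE XS (subsetP vX) // mem_old set11.
rewrite /degree -im -/S; have [/bigcupP[A AM vA]|_] := boolP (v \in cover M); last first.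
  by rewrite addn0 leq_imset_card.
rewrite addn1 ltn_neqAle leq_imset_card andbT; apply/negP => /imset_injP inj.
pose m : M_ := exist _ A AM.
have : 1 < #|A :\ v|.
  have := pm_card pm (subsetP MF _ AM); rewrite (cardsD1 v) vA.
  by move: d3; clear; lia.
case/card_gt1P => x [y [/setD1P[xv xA] /setD1P[yv yA] xy]].
have chS z : z \in A -> z != v -> child m z \in S.
  by move=> zA zv; rewrite inE child_stack // mem_child eq_sym zv.
case/eqP: xy; apply: (child_inj (m := m)) => //.
by apply: inj; rewrite ?chS // !parent_child.
Qed.

Section Automorphisms.

(** The default of [insubd] matters only when [f] does not preserve [M]. *)
Definition smap (f : V -> V) (w : svert) : svert :=
  match w with inl v => inl (f v) | inr m => inr (insubd m (f @: val m)) end.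

Definition preserves (f : V -> V) := forall A, A \in M -> f @: A \in M.

Lemma smap_inr f m : preserves f ->
  exists2 m', smap f (inr m) = inr m' & val m' = f @: val m.
Proof.
move=> fM; exists (insubd m (f @: val m)) => //.
by rewrite val_insubd fM ?(valP m).
Qed.

Lemma smap_old f A : smap f @: old A = old (f @: A).
Proof. by rewrite /old -!imset_comp. Qed.

Lemma smap_child f m m' x : smap f (inr m) = inr m' -> val m' = f @: val m ->
  injective f -> smap f @: child m x = child m' (f x).
Proof.
move=> e e' fi; rewrite /child imsetU1 smap_old e; congr (_ |: old _).
rewrite e'; apply/setP => v; apply/imsetP/setD1P.
  case=> w /setD1P[wx wm] ->; rewrite (inj_eq fi) wx; split=> //; exact: imset_f.
case=> vx /imsetP[w wm ev]; exists w => //; rewrite in_setD1 wm andbT.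
by apply: contraNneq vx; rewrite ev => ->.
Qed.

Lemma smap_aut f : simplicial_aut F f -> preserves f -> simplicial_aut stack (smap f).
Proof.
move=> fA fM; have [fi fF] := fA; split.
  move=> [v|m] [w|n] //; first by case=> /fi ->.
  have [m' -> em] := smap_inr m fM; have [n' -> en] := smap_inr n fM.
  case=> e; congr inr; apply: val_inj; apply: (imset_inj fi).
  by rewrite -em -en e.
move=> X /stackP[A AF AM ->|m x xm ->].
  rewrite smap_old old_stack ?fF //; apply: contra AM => fAM.
  have : [set f @: B | B : {set V} in M] = M.
    apply/eqP; rewrite eqEcard (card_imset _ (imset_inj fi)) leqnn andbT.
    by apply/subsetP => _ /imsetP[B BM ->]; exact: fM.
  by move/setP/(_ (f @: A)); rewrite fAM => /imsetP[B BM /(imset_inj fi) ->].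
have [m' e em] := smap_inr m fM.
by rewrite (smap_child _ e em fi) child_stack // em imset_f.
Qed.

Hypothesis old_degree : forall v, degree stack (inl v : svert) != d.

(* New vertices are recognised by their degree, so automorphisms descend. *)
Lemma stack_aut g : simplicial_aut stack g ->
  exists f, [/\ simplicial_aut F f, preserves f & g =1 smap f].
Proof.
move=> gA; have [gi gS] := gA.
have /fin_all_exists[f fE] : forall v, exists w, g (inl v) = inl w.
  move=> v; case e : (g (inl v)) => [w|m]; first by exists w.
  by have := old_degree v; rewrite -(aut_degree _ gA) e degree_new eqxx.
have /fin_all_exists[h hE] : forall m, exists m', g (inr m) = inr m'.
  move=> m; case e : (g (inr m)) => [w|m']; last by exists m'.
  by have := old_degree w; rewrite -e (aut_degree _ gA) degree_new eqxx.
have fi : injective f by move=> v w e; have := fE v; rewrite e -fE => /gi[].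
have g_old A : g @: old A = old (f @: A).
  by rewrite /old -!imset_comp; apply: eq_imset => v /=; rewrite fE.
have hf m : val (h m) = f @: val m.
  apply/esym/eqP; rewrite eqEcard card_imset // !(pm_card pm (valMF _)) leqnn andbT.
  apply/subsetP => _ /imsetP[v vm ->].
  (* The child of [m] opposite to [x] contains [v] and the new vertex of [m]. Its image is a facet
     through the new vertex of [h m], hence a child of [h m], so [f v] lies in [h m]. *)
  have [x xm xv] : exists2 x, x \in val m & x != v.
    have : 0 < #|val m :\ v|.
      have := pm_card pm (valMF m); rewrite (cardsD1 v) vm.
      by move: d3; clear; lia.
    by case/card_gt0P => x /setD1P[xv xm]; exists x.
  have := gS _ (child_stack xm); rewrite /child imsetU1 g_old hE.
  case/stackP => [A _ _ /setP/(_ (inr (h m)))|m' y ym e].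
    by rewrite inr_old setU11.
  have := congr1 (fun X => (inr (h m) : svert) \in X) e.
  rewrite setU11 inr_child => /esym/eqP ->.
  have := congr1 (fun X => (inl (f v) : svert) \in X) e.
  rewrite in_setU1 mem_old mem_child mem_imset // in_setD1 vm (eq_sym v) xv.
  by case/esym/andP.
exists f; split.
- split=> // A AF; have [AM|AM] := boolP (A \in M).
    by have := valMF (h (exist _ A AM)); rewrite hf.
  have := gS _ (old_stack AF AM); rewrite g_old.
  case/stackP => [B BF _ /old_inj -> //|m x _ /setP/(_ (inr m))].
  by rewrite inr_old inr_child eqxx.
- by move=> A AM; have := valP (h (exist _ A AM)); rewrite hf.
- move=> [v|m]; first exact: fE.
  rewrite hE /=; congr inr; apply: val_inj.
  by rewrite val_insubd -hf (valP (h m)).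
Qed.

End Automorphisms.
End Stack.

(** * The order complex of a polytope *)

Section OrderComplex.
Variables (T : finType) (le : rel T) (d : nat) (bot top : T).
Implicit Types (x y z : T) (Phi Psi : {set T}).

Definition pface := {x : T | proper_face le x}.
Implicit Types (A B s : {set pface}) (v w : pface).

Definition embed A : {set T} := val @: A.
Definition oc_facets : {set {set pface}} :=
  [set A | is_chain le (embed A) && (#|A| == d)].
Definition flag_of A : {set T} := bot |: (top |: embed A).
Definition facet_of Phi : {set pface} := val @^-1: Phi.

Hypothesis d3 : 3 <= d.
Hypothesis po : is_partial_order le.
Hypothesis le_bot : forall y, le bot y.
Hypothesis le_top : forall y, le y top.
Hypothesis flagN : forall Phi, is_flag le Phi -> #|Phi| = d + 2.
Hypothesis diam : diamond_condition le.
Hypothesis sfc : strongly_flag_connected le.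

Let lexx : reflexive le. Proof. by case: po. Qed.
Let anti : antisymmetric le. Proof. by case: po. Qed.
Let tr : transitive le. Proof. by case: po. Qed.

Lemma bot_in_flag Phi : is_flag le Phi -> bot \in Phi.
Proof. by move=> fP; apply: (mem_flag lexx fP) => y _; rewrite le_bot. Qed.

Lemma top_in_flag Phi : is_flag le Phi -> top \in Phi.
Proof. by move=> fP; apply: (mem_flag lexx fP) => y _; rewrite le_top orbT. Qed.

Let proper_faceE x := proper_faceE x po le_bot le_top.

Lemma bot_top : bot != top.
Proof.
apply/eqP => e.
have : is_chain le [set bot] by apply/chainP => x y /set1P -> /set1P ->; rewrite lexx.
case/chain_sub_flag => Phi fP _.
have : Phi \subset [set bot].
  by apply/subsetP => x _; rewrite inE; apply/eqP/anti; rewrite le_bot e le_top.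
by move/subset_leq_card; rewrite cards1 (flagN fP); lia.
Qed.

Lemma mem_embed v A : (val v \in embed A) = (v \in A).
Proof. by rewrite mem_imset //; exact: val_inj. Qed.

Lemma embed_proper x A : x \in embed A -> (x != bot) && (x != top).
Proof. by case/imsetP => v _ ->; rewrite -proper_faceE (valP v). Qed.

Lemma card_embed A : #|embed A| = #|A|. Proof. exact/card_imset/val_inj. Qed.

Lemma card_flag_of A : #|flag_of A| = #|A| + 2.
Proof.
have nb : bot \notin embed A by apply/negP => /embed_proper; rewrite eqxx.
have nt : top \notin embed A by apply/negP => /embed_proper; rewrite eqxx andbF.
by rewrite /flag_of !cardsU1 in_setU1 (negbTE bot_top) (negbTE nb) nt card_embed addn2.
Qed.

Lemma oc_facet_flag A : A \in oc_facets -> is_flag le (flag_of A).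
Proof.
rewrite inE => /andP[ch /eqP cA]; apply: (chain_flag_card flagN); last first.
  by rewrite card_flag_of cA.
by do 2?[apply: chainU1 => //]; move=> y _; rewrite ?le_bot ?le_top ?orbT.
Qed.

Lemma facet_ofK Phi : is_flag le Phi -> flag_of (facet_of Phi) = Phi.
Proof.
move=> fP; apply/setP => x; rewrite !inE.
have [->|xb] := eqVneq x bot; first by rewrite (bot_in_flag fP).
have [->|xt] := eqVneq x top; first by rewrite (top_in_flag fP) orbT.
rewrite /=; apply/imsetP/idP => [[v]|xP]; first by rewrite inE => vP ->.
have px : proper_face le x by rewrite proper_faceE xb.
by exists (Sub x px); rewrite ?inE ?SubK.
Qed.

Lemma flag_ofK A : facet_of (flag_of A) = A.
Proof.
apply/setP => v; rewrite !inE mem_embed; have := valP v.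
by rewrite proper_faceE => /andP[/negbTE -> /negbTE ->].
Qed.

Lemma facet_of_oc Phi : is_flag le Phi -> facet_of Phi \in oc_facets.
Proof.
move=> fP; rewrite inE; have := flagN fP; rewrite -{1}(facet_ofK fP) card_flag_of.
move/eqP; rewrite eqn_add2r => ->; rewrite andbT.
apply: sub_chain (flag_chain fP); apply/subsetP => x /imsetP[v].
by rewrite inE => vP ->.
Qed.

Lemma facet_of_sub Phi A : (embed A \subset Phi) = (A \subset facet_of Phi).
Proof.
apply/subsetP/subsetP => [h v vA|h x /imsetP[v /h]].
  by rewrite inE h // mem_embed.
by rewrite inE => vP ->.
Qed.

(** Counting flag members below a face gives a strictly increasing height. It serves to find
    neighbours in a flag and to show that a flag preserved as a set is fixed pointwise. *)
Lemma below_lt Phi x y : is_flag le Phi -> y \in Phi -> le x y -> x != y ->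
  #|[set a in Phi | le a x]| < #|[set a in Phi | le a y]|.
Proof.
move=> fP yP xy nxy; apply/proper_card/properP; split.
  by apply/subsetP => a; rewrite !inE => /andP[-> ax]; exact: tr xy.
exists y; rewrite !inE yP ?lexx //=; apply: contra nxy => yx.
by apply/eqP/anti; rewrite xy yx.
Qed.

Lemma flag_neighbours Phi x : is_flag le Phi -> x \in Phi -> x != bot -> x != top ->
  exists y z, [/\ y \in Phi, z \in Phi, Defs.ltP le y x, Defs.ltP le x z &
    {in Phi, forall a, a != x -> le a y || le z a}].
Proof.
move=> fP xP xb xt; have cmp := chainP _ _ (flag_chain fP).
have [y [yP yx ymax]] : exists y, [/\ y \in Phi, Defs.ltP le y x &
    {in Phi, forall a, Defs.ltP le a x -> le a y}].
  case: (@arg_maxnP _ bot (fun a => (a \in Phi) && Defs.ltP le a x)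
    (fun a => #|[set b in Phi | le b a]|)).
    by rewrite bot_in_flag // /Defs.ltP le_bot eq_sym xb.
  move=> y /andP[yP yx] h; exists y; split=> // a aP ax.
  have [->|nay] := eqVneq y a; first exact: lexx.
  case/orP: (cmp _ _ aP yP) => // ya.
  by have := below_lt fP aP ya nay; rewrite ltnNge => /negP[]; apply: h; rewrite aP.
have [z [zP xz zmin]] : exists z, [/\ z \in Phi, Defs.ltP le x z &
    {in Phi, forall a, Defs.ltP le x a -> le z a}].
  case: (@arg_minnP _ top (fun a => (a \in Phi) && Defs.ltP le x a)
    (fun a => #|[set b in Phi | le b a]|)).
    by rewrite top_in_flag // /Defs.ltP le_top xt.
  move=> z /andP[zP xz] h; exists z; split=> // a aP ax.
  have [->|nay] := eqVneq a z; first exact: lexx.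
  case/orP: (cmp _ _ aP zP) => // az.
  by have := below_lt fP zP az nay; rewrite ltnNge => /negP[]; apply: h; rewrite aP.
exists y, z; split=> // a aP nax; case/orP: (cmp _ _ aP xP) => h.
  by rewrite ymax // /Defs.ltP nax.
by rewrite orbC zmin // /Defs.ltP eq_sym nax.
Qed.

(** The neighbours [y] and [z] of [x] in the flag differ by two in rank, so the diamond condition
    gives exactly one other face between them. *)
Lemma flag_diamond Phi x : is_flag le Phi -> x \in Phi -> x != bot -> x != top ->
  exists x', [/\ x' \notin Phi, is_flag le (x' |: Phi :\ x) &
    forall Psi, is_flag le Psi -> Phi :\ x \subset Psi ->
      Psi = Phi \/ Psi = x' |: Phi :\ x].
Proof.
move=> fP xP xb xt.
have [y [z [yP zP yx xz gap]]] := flag_neighbours fP xP xb xt.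
have /andP[nyx leyx] := yx; have /andP[nxz lexz] := xz.
have gt0 a b : Defs.ltP le a b -> ~~ le b a.
  by case/andP=> nab ab; apply: contra nab => ba; apply/eqP/anti; rewrite ab ba.
have rkx : rk le x = (rk le y).+1.
  rewrite !(rk_flag flagN po fP) // (cardsD1 x) inE xP lexx; congr _.+1.
  apply: eq_card => a; rewrite !inE; apply/and3P/andP => [[nax aP ax]|[aP ay]].
    split=> //; case/orP: (gap a aP nax) => // za.
    by case/negP: (gt0 _ _ xz); exact: tr ax.
  split=> //; last exact: tr leyx.
  by apply: contraTneq ay => ->; exact: gt0.
have rkz : rk le z = (rk le x).+1.
  rewrite !(rk_flag flagN po fP) // (cardsD1 z) inE zP lexx; congr _.+1.
  apply: eq_card => a; rewrite !inE; apply/and3P/andP => [[naz aP az]|[aP ax]].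
    split=> //; have [->|nax] := eqVneq a x; first exact: lexx.
    case/orP: (gap a aP nax) => [ay|za]; first exact: tr leyx.
    by case/eqP: naz; apply: anti; rewrite az za.
  split=> //; last exact: tr lexz.
  by apply: contraTneq ax => ->; exact: gt0.
have yz : Defs.ltP le y z.
  rewrite /Defs.ltP (tr leyx lexz) andbT; apply: contraTneq lexz => <-; exact: gt0.
have := diam yz; rewrite rkz rkx addn2 => /(_ erefl) /eqP/cards2P[p [q [npq epq]]].
have [x' nx' ex'] : exists2 x', x' != x &
    forall H, Defs.ltP le y H && Defs.ltP le H z = (H == x) || (H == x').
  have : x \in [set p; q] by rewrite -epq inE yx.
  have hE H : Defs.ltP le y H && Defs.ltP le H z = (H == p) || (H == q).
    by have := in_set2 H p q; rewrite -epq inE.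
  rewrite in_set2 => /orP[] /eqP e; [exists q; last move=> H|exists p; last move=> H].
  - by rewrite e eq_sym.
  - by rewrite hE e.
  - by rewrite e.
  - by rewrite hE e orbC.
have /andP[/andP[nyx' leyx'] /andP[nxz' lexz']] : Defs.ltP le y x' && Defs.ltP le x' z.
  by rewrite ex' eqxx orbT.
have x'P : x' \notin Phi.
  apply/negP => /gap /(_ nx') /orP[] h.
    by case/eqP: nyx'; apply: anti; rewrite leyx' h.
  by case/eqP: nxz'; apply: anti; rewrite lexz' h.
have cD : #|Phi :\ x| = d.+1.
  by have := flagN fP; rewrite (cardsD1 x) xP addn2 add1n => -[].
exists x'; split=> //.
  apply: (chain_flag_card flagN); last first.
    by rewrite cardsU1 cD !inE (negbTE x'P) andbF addn2.
  apply: chainU1 => //; first exact: sub_chain (subsetDl _ _) (flag_chain fP).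
  move=> a /setD1P[nax aP]; case/orP: (gap a aP nax) => h.
    by rewrite orbC (tr h leyx').
  by rewrite (tr lexz' h).
move=> Psi fS sub.
have [H HS] : exists H, Psi :\: (Phi :\ x) = [set H].
  apply/cards1P; by rewrite cardsD (setIidPr sub) cD (flagN fS) addn2 subSnn.
have eS : Psi = H |: Phi :\ x.
  by rewrite -[LHS](setID _ (Phi :\ x)) (setIidPr sub) HS setUC.
have : H \in Psi :\: (Phi :\ x) by rewrite HS set11.
case/setDP => HP Hn.
have sub' a : a \in Phi -> a != x -> a \in Psi.
  by move=> aP nax; apply: (subsetP sub); rewrite in_setD1 nax.
have nzx : z != x by rewrite eq_sym.
have yS := sub' y yP nyx; have zS := sub' z zP nzx.
(* The rank of [a] counted in [Phi] and in [Psi] must agree, so the element [H] replacing [x] is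
   below [a] exactly when [x] is. This forces [H] between [y] and [z]. *)
have cnt a : a \in Phi -> a != x -> (le x a : nat) = le H a.
  move=> aP nax; have := rk_flag flagN po fP aP.
  rewrite (rk_flag flagN po fS (sub' a aP nax)).
  rewrite (cardsD1 H) [in RHS](cardsD1 x) !in_set HP xP /=.
  have -> : [set b in Phi | le b a] :\ x = [set b in Psi | le b a] :\ H.
    apply/setP => b; rewrite !in_setD1 !in_set eS in_setU1 in_setD1.
    have [->|nbH] /= := eqVneq b H; last by case: eqP.
    by move: Hn; rewrite in_setD1; case: eqP => //= _ /negbTE ->.
  by move/addIn.
have Hy : ~~ le H y by have := cnt y yP nyx; rewrite (negbTE (gt0 _ _ yx)); case: (le H y).
have Hz : le H z by have := cnt z zP nzx; rewrite lexz; case: (le H z).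
have yH : le y H.
  by have := chainP _ _ (flag_chain fS) _ _ HP yS; rewrite (negbTE Hy).
have : (H == x) || (H == x').
  rewrite -ex' /Defs.ltP yH Hz !andbT; apply/andP; split.
    by apply: contraNneq Hy => <-; exact: lexx.
  by apply: contraNneq Hn => ->; rewrite in_setD1 zP nzx.
by case/orP => /eqP e; [left|right]; rewrite eS e // setD1K.
Qed.

Lemma oc_ridge A s : A \in oc_facets -> s \subset A -> #|s| = d.-1 ->
  #|[set B in oc_facets | s \subset B]| = 2.
Proof.
move=> AF sA cs; have fA := oc_facet_flag AF.
have cA : #|A| = d by move: AF; rewrite inE => /andP[_ /eqP].
have [x ex] : exists x : pface, A :\: s = [set x].
  by apply/cards1P; rewrite cardsD (setIidPr sA) cA cs; move: d3; clear; lia.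
have /setDP[xA xs] : x \in A :\: s by rewrite ex set11.
have es : s = A :\ x by rewrite -ex setDDr setDv set0U (setIidPr sA).
have xP : val x \in flag_of A by rewrite !in_setU1 mem_embed xA !orbT.
have /andP[xb xt] : (val x != bot) && (val x != top) by rewrite -proper_faceE (valP x).
have [x' [x'P fB uniq]] := flag_diamond fA xP xb xt.
pose B := facet_of (x' |: flag_of A :\ val x).
have AB : A != B.
  apply/eqP => /setP/(_ x); rewrite xA inE in_setU1 in_setD1 eqxx orbF.
  by move/esym/eqP => e; rewrite -e xP in x'P.
rewrite (_ : [set _ in _ | _] = [set A; B]) ?cards2 ?AB //.
apply/setP => C; rewrite inE in_set2; apply/andP/orP => [[CF sC]|[] /eqP ->].
- have sub : flag_of A :\ val x \subset flag_of C.
    apply/subsetP => y /setD1P[yx]; rewrite !in_setU1.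
    case/or3P => [->//|->|/imsetP[w wA ey]]; first by rewrite orbT.
    rewrite ey mem_embed (subsetP sC) ?orbT // es in_setD1 wA andbT.
    by apply: contraNneq yx => <-; rewrite ey.
  by have [e|e] := uniq _ (oc_facet_flag CF) sub; [left|right]; rewrite -(flag_ofK C) e ?flag_ofK.
- by rewrite AF.
- split; first exact: facet_of_oc.
  apply/subsetP => w ws; rewrite inE in_setU1 in_setD1 (inj_eq val_inj).
  move: ws; rewrite es in_setD1 => /andP[-> wA].
  by rewrite !in_setU1 mem_embed wA !orbT.
Qed.

Lemma oc_connect s A B : A \in oc_facets -> B \in oc_facets -> s \subset A -> s \subset B ->
  connect (facet_nbr oc_facets s) A B.
Proof.
move=> AF BF sA sB.
have [p [pF pa plast ps]] := sfc (oc_facet_flag AF) (oc_facet_flag BF).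
rewrite -(flag_ofK A) -(flag_ofK B) -plast {plast}.
have {}ps : all (fun X : {set T} => embed s \subset X) p.
  apply: sub_all ps => X; apply: subset_trans; rewrite subsetI !facet_of_sub.
  by rewrite !flag_ofK sA.
have sF : embed s \subset flag_of A by rewrite facet_of_sub flag_ofK.
move: (flag_of A) (oc_facet_flag AF) pF pa ps sF.
elim: p => [|Psi p IH] Phi fP //=.
move=> /andP[fS pF] /andP[adj pa] /andP[sS ps] sP.
apply: connect_trans (IH _ fS pF pa ps sS); apply: connect1; apply/and5P; split.
- exact: facet_of_oc.
- exact: facet_of_oc.
- by rewrite -facet_of_sub.
- by rewrite -facet_of_sub.
- rewrite -(eqP adj) -(card_embed (_ :\: _)); apply/subset_leq_card/subsetP => x.
  by case/imsetP => v; rewrite !inE => h ->.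
Qed.

Lemma chain_oc_facet A : is_chain le (embed A) -> exists2 B, B \in oc_facets & A \subset B.
Proof.
case/chain_sub_flag => Phi fP; rewrite facet_of_sub => sA.
by exists (facet_of Phi) => //; exact: facet_of_oc.
Qed.

Lemma oc_pseudomanifold : pseudomanifold d oc_facets.
Proof.
split.
- move=> v; have : is_chain le (embed [set v]).
    apply/chainP => x y /imsetP[w /set1P -> ->] /imsetP[w' /set1P -> ->].
    by rewrite lexx.
  by case/chain_oc_facet => B BF; rewrite sub1set; exists B.
- have : is_chain le (embed set0).
    by apply/chainP => x y /imsetP[w]; rewrite inE.
  by case/chain_oc_facet => B BF _; exists B.
- by move=> A; rewrite inE => /andP[_ /eqP].
- exact: oc_ridge.
- exact: oc_connect.
Qed.

(** Pairwise comparable faces form a chain, so the complex has no missing simplex: a vertex joined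
    to all of a facet belongs to it by maximality of the flag. *)
Lemma oc_clique A w : A \in oc_facets ->
  {in A, forall a, exists2 C, C \in oc_facets & (w \in C) && (a \in C)} -> w \in A.
Proof.
move=> AF h; have fA := oc_facet_flag AF.
rewrite -(flag_ofK A) inE; apply: (mem_flag lexx fA) => y.
rewrite !in_setU1 => /or3P[/eqP ->|/eqP ->|/imsetP[a aA ->]].
- by rewrite le_bot orbT.
- by rewrite le_top.
- have [C CF /andP[wC aC]] := h a aA; move: CF; rewrite inE => /andP[/chainP ch _].
  by apply: ch; rewrite mem_embed.
Qed.

Section Action.
Variable g : {perm T}.
Hypothesis gA : g \in Aut_poset le.

Lemma aut_le x y : le (g x) (g y) = le x y.
Proof. by move: gA; rewrite inE => /forallP/(_ x)/forallP/(_ y)/eqP. Qed.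

Lemma aut_bot : g bot = bot.
Proof. by apply: anti; rewrite le_bot andbT -[X in le _ X](permKV g) aut_le le_bot. Qed.

Lemma aut_top : g top = top.
Proof. by apply: anti; rewrite le_top /= -[X in le X _](permKV g) aut_le le_top. Qed.

Lemma aut_proper x : proper_face le (g x) = proper_face le x.
Proof.
by rewrite !proper_faceE -(inj_eq (@perm_inj _ g) x bot) -(inj_eq (@perm_inj _ g) x top) aut_bot aut_top.
Qed.
End Action.

Definition oc_act (g : {perm T}) v : pface := insubd v (g (val v)).

Lemma val_oc_act g v : g \in Aut_poset le -> val (oc_act g v) = g (val v).
Proof. by move=> gA; rewrite val_insubd aut_proper // (valP v). Qed.

Lemma oc_act_aut g : g \in Aut_poset le -> simplicial_aut oc_facets (oc_act g).
Proof.
move=> gA; have gi : injective (oc_act g).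
  by move=> v w /(congr1 val); rewrite !val_oc_act // => /perm_inj/val_inj.
split=> // A; rewrite !inE card_imset // => /andP[/chainP ch ->]; rewrite andbT.
apply/chainP => x y /imsetP[_ /imsetP[v vA ->] ->] /imsetP[_ /imsetP[w wA ->] ->].
by rewrite !val_oc_act // !aut_le // ch // mem_embed.
Qed.

Lemma oc_actM g h v : g \in Aut_poset le -> h \in Aut_poset le ->
  (g * h)%g \in Aut_poset le -> oc_act (g * h)%g v = oc_act h (oc_act g v).
Proof. by move=> gA hA ghA; apply: val_inj; rewrite !val_oc_act // permM. Qed.

(** An automorphism preserving a flag preserves heights in it, so it fixes the flag pointwise, and
    [aut_rigid] spreads this to all proper faces. *)
Lemma oc_act_free g A : g \in Aut_poset le -> A \in oc_facets ->
  oc_act g @: A = A -> g = 1%g.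
Proof.
move=> gA AF gAA; have fA := oc_facet_flag AF; have cmp := chainP _ _ (flag_chain fA).
have gP y : y \in flag_of A -> g y \in flag_of A.
  rewrite !in_setU1 => /or3P[/eqP ->|/eqP ->|/imsetP[a aA ->]].
  - by rewrite aut_bot ?eqxx.
  - by rewrite aut_top ?eqxx ?orbT.
  - by rewrite -val_oc_act // mem_embed -{1}gAA imset_f ?orbT.
have gS : [set g y | y in flag_of A] = flag_of A.
  apply/eqP; rewrite eqEcard card_imset ?leqnn ?andbT; last exact: perm_inj.
  by apply/subsetP => _ /imsetP[y yA ->]; exact: gP.
have cnt y : #|[set a in flag_of A | le a (g y)]| = #|[set a in flag_of A | le a y]|.
  rewrite -[RHS](card_imset _ (@perm_inj _ g)); apply: eq_card => a.
  rewrite inE; apply/andP/imsetP => [[]|[b]].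
    by rewrite -{1}gS => /imsetP[b bA ->]; rewrite aut_le // => h; exists b; rewrite // inE bA.
  by rewrite inE => /andP[bA by_] ->; rewrite gP // aut_le.
have fixA : {in A, oc_act g =1 id}.
  move=> v vA; apply: val_inj; rewrite val_oc_act //; apply/eqP.
  have vP : val v \in flag_of A by rewrite !in_setU1 mem_embed vA !orbT.
  apply: contraT => ne; case/orP: (cmp _ _ (gP _ vP) vP) => h.
    by have := below_lt fA vP h ne; rewrite cnt ltnn.
  by rewrite eq_sym in ne; have := below_lt fA (gP _ vP) h ne; rewrite cnt ltnn.
have id_aut : simplicial_aut oc_facets id by split=> // B BF; rewrite imset_id.
have fix_ := aut_rigid oc_pseudomanifold (oc_act_aut gA) id_aut AF fixA.
apply/permP => x; rewrite perm1.
have [->|xb] := eqVneq x bot; first exact: aut_bot.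
have [->|xt] := eqVneq x top; first exact: aut_top.
have px : proper_face le x by rewrite proper_faceE xb.
by have := val_oc_act (Sub x px) gA; rewrite fix_.
Qed.

End OrderComplex.

(* A facet A, its d - 1 neighbours through v, and the second neighbour of one of
   them are distinct, since the complex has no missing simplex. *)
Lemma clique_complex_degree (V : finType) (d : nat) (F : {set {set V}}) :
  3 <= d -> pseudomanifold d F ->
  (forall A w, A \in F ->
    {in A, forall a, exists2 C, C \in F & (w \in C) && (a \in C)} -> w \in A) ->
  forall v, d < degree F v.
Proof.
move=> d3 pm clique v; have [A AF vA] := pm_cover pm v.
have cA := pm_card pm AF.
have other B x : B \in F -> x \in B ->
    exists C, [/\ C \in F, x \notin C & B :\ x \subset C].
  move=> BF xB; have cs : #|B :\ x| = d.-1.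
    by rewrite -(pm_card pm BF) [in RHS](cardsD1 x) xB.
  have := pm_ridge pm BF (subsetDl _ _) cs; rewrite (cardsD1 B) inE BF subsetDl add1n => -[c1].
  have /card_gt0P[C] : 0 < #|[set C in F | B :\ x \subset C] :\ B| by rewrite c1.
  rewrite !inE => /and3P[CB CF sC]; exists C; split=> //; apply: contra CB => xC.
  rewrite eq_sym eqEcard (pm_card pm BF) (pm_card pm CF) leqnn andbT.
  by rewrite -(setD1K xB) subUset sub1set xC.
have /fin_all_exists[nb nbP] : forall x, exists C, x \in A ->
    [/\ C \in F, x \notin C & A :\ x \subset C].
  move=> x; have [xA|_] := boolP (x \in A); last by exists set0.
  by have [C] := other A x AF xA; exists C.
have : 1 < #|A :\ v| by move: cA; rewrite (cardsD1 v) vA; move: d3; clear; lia.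
case/card_gt1P => x [y [/setD1P[xv xA] /setD1P[yv yA] xy]].
have [BF xB sB] := nbP x xA.
have yB : y \in nb x by apply: (subsetP sB); rewrite in_setD1 eq_sym xy.
have [C [CF yC sC]] := other _ y BF yB.
have xC : x \notin C.
  apply/negP => xC.
  (* The vertex [w] of [nb x] outside [A] would be joined to [x] through [C] and to the rest of [A]
     through [nb x], against the clique property. *)
  have [w wB wA] : exists2 w, w \in nb x & w \notin A.
    apply/subsetPn; apply: contra xB => sBA.
    have -> // : nb x = A.
    by apply/eqP; rewrite eqEcard sBA (pm_card pm BF) cA leqnn.
  case/negP: (wA); apply: clique => // a aA; have [->|ax] := eqVneq a x.
    exists C => //; rewrite xC andbT (subsetP sC) // in_setD1 wB andbT.
    by apply: contraNneq wA => ->.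
  by exists (nb x) => //; rewrite wB (subsetP sB) // in_setD1 ax.
pose S := C |: (A |: nb @: (A :\ v)).
have nb_inj : {in A :\ v &, injective nb}.
  move=> p q /setD1P[_ pA] /setD1P[_ qA] e; apply/eqP; apply: contraT => pq.
  have [_ pp _] := nbP p pA; have [_ _ sq] := nbP q qA.
  by rewrite e (subsetP sq) // in_setD1 pq in pp.
have AS : A \notin nb @: (A :\ v).
  by apply/imsetP => -[p /setD1P[_ pA] e]; have [_] := nbP p pA; rewrite -e pA.
have CS : C \notin A |: nb @: (A :\ v).
  rewrite in_setU1 negb_or; apply/andP; split; first by apply: contraNneq yC => ->.
  (* A neighbour [nb p] contains all of [A] but [p], whereas [C] misses both [x] and [y]. *)
  apply/imsetP => -[p /setD1P[_ pA] e]; have [_ _ sp] := nbP p pA.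
  have [px|px] := eqVneq x p.
    by case/negP: yC; rewrite e (subsetP sp) // in_setD1 -px eq_sym xy.
  by case/negP: xC; rewrite e (subsetP sp) // in_setD1 px.
have <- : #|S| = d.+1.
  rewrite /S !cardsU1 CS AS (card_in_imset nb_inj) -cA [in RHS](cardsD1 v) vA.
  by rewrite !add1n.
apply/subset_leq_card/subsetP => B; rewrite !in_setU1 inE.
case/or3P => [/eqP ->|/eqP ->|/imsetP[p /setD1P[pv pA] ->]].
- rewrite CF (subsetP sC) // in_setD1 eq_sym yv (subsetP sB) //.
  by rewrite in_setD1 eq_sym xv.
- by rewrite AF.
- by have [-> _ sp] := nbP p pA; rewrite (subsetP sp) // in_setD1 eq_sym pv.
Qed.

From mathcomp Require Import all_algebra.
From mathcomp Require Import all_classical all_reals all_analysis.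
From mathcomp Require Import ring.
Import Order.TTheory GRing.Theory Num.Theory.
Import numFieldNormedType.Exports.
Local Open Scope ring_scope.

(** * Geometric cells *)

Section Cells.
Variables (R : realType) (n : nat) (V : finType) (pos : V -> 'rV[R]_n).
Implicit Types (A B : {set V}) (v u : V) (w : V -> R) (x a : 'rV[R]_n).

Definition bary w : 'rV[R]_n := \sum_v w v *: pos v.

(** Weights live on all of [V] and vanish off [A], so those on different facets can be compared
    pointwise. *)
Definition weight_on A w : Prop :=
  [/\ forall v, 0 <= w v, \sum_v w v = 1 & forall v, v \notin A -> w v = 0].

Definition cell A : set 'rV[R]_n := [set x | exists2 w, weight_on A w & x = bary w]%classic.

Lemma dotr_bary a w : dotr a (bary w) = \sum_v w v * dotr a (pos v).
Proof.
rewrite /dotr /bary.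
under eq_bigr => i _ do rewrite summxE mulr_sumr.
rewrite exchange_big /=; apply: eq_bigr => v _; rewrite mulr_sumr.
by apply: eq_bigr => i _; rewrite mxE mulrCA.
Qed.

Lemma dotrDZ a b (c : R) x : dotr (a - c *: b) x = dotr a x - c * dotr b x.
Proof.
rewrite /dotr mulr_sumr -sumrB; apply: eq_bigr => i _.
by rewrite !mxE mulrBl mulrA.
Qed.

Lemma weight_sub A B w : A \subset B -> weight_on A w -> weight_on B w.
Proof. by move=> /fintype.subsetP AB [w0 w1 wA]; split=> // v vB; apply/wA/(contra (AB v)). Qed.

Lemma weight_sum A w (f : V -> R) : weight_on A w ->
  \sum_v w v * f v = \sum_(v in A) w v * f v.
Proof.
case=> _ _ wA; rewrite (bigID (mem A)) /= [X in _ + X]big1 ?addr0 // => v /wA ->.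
by rewrite mul0r.
Qed.

Lemma cell_sub A B : A \subset B -> (cell A `<=` cell B)%classic.
Proof. by move=> AB x [w wA ->]; exists w => //; exact: weight_sub wA. Qed.

Lemma weight_delta A v : v \in A -> weight_on A (fun u => (u == v)%:R).
Proof.
move=> vA; split=> [u||u uA]; first by rewrite ler0n.
  by rewrite (bigD1 v) //= eqxx big1 ?addr0 // => u /negbTE ->.
by case: eqP uA => // ->; rewrite vA.
Qed.

Lemma bary_delta v : bary (fun u => (u == v)%:R) = pos v.
Proof.
rewrite /bary (bigD1 v) //= eqxx scale1r big1 ?addr0 // => u /negbTE ->.
by rewrite scale0r.
Qed.

Lemma pos_cell A v : v \in A -> cell A (pos v).
Proof. by move=> vA; exists (fun u => (u == v)%:R); [exact: weight_delta|rewrite bary_delta]. Qed.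

Lemma cell_nonempty A : (cell A !=set0)%classic <-> A != finset.set0.
Proof.
split=> [[x [w [w0 w1 wA] _]]|/finset.set0Pn[v vA]]; last by exists (pos v); exact: pos_cell.
apply/eqP => A0; have : \sum_v w v = 0 :> R.
  by apply: big1 => v _; apply: wA; rewrite A0 inE.
by rewrite w1 => /eqP; rewrite oner_eq0.
Qed.

Lemma conv_hull_cell A v0 : v0 \in A ->
  conv_hull [seq pos v | v <- enum A] = cell A.
Proof.
move=> v0A; set S := [seq _ | _ <- _].
pose e (i : 'I_(size S)) := nth v0 (enum A) i.
have ltS (i : 'I_(size S)) : (i < size (enum A))%N by rewrite -(size_map pos) ltn_ord.
have eA i : e i \in A by rewrite -mem_enum mem_nth.
have SE (i : 'I_(size S)) : S`_i = pos (e i) by rewrite (nth_map v0).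
rewrite eqEsubset; split=> [x [w [w0 w1 ->]]|_ [w [w0 w1 wA] ->]].
  exists (fun v => \sum_(i | e i == v) w i).
    split=> [v||v vA]; first by rewrite sumr_ge0.
      by rewrite -w1 (partition_big e xpredT).
    by rewrite big_pred0 // => i; apply: contraNF vA => /eqP <-.
  rewrite /bary (partition_big e xpredT) //=; apply: eq_bigr => v _.
  by rewrite scaler_suml; apply: eq_bigr => i /eqP <-; rewrite SE.
have sumE (U : zmodType) (f : V -> U) :
    (forall v, v \notin A -> f v = 0) -> \sum_i f (e i) = \sum_v f v.
  move=> f0; rewrite [RHS](bigID (mem A)) /= [X in _ + X]big1 // addr0.
  rewrite -[RHS]big_enum /= (big_nth v0) -(size_map pos).
  by rewrite -(big_mkord xpredT (fun i => f (nth v0 (enum A) i))).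
exists (w \o e); split=> [i||]; first exact: w0.
  by rewrite [LHS]sumE.
rewrite /bary -sumE; last by move=> v /wA ->; rewrite scale0r.
by apply: eq_bigr => i _; rewrite SE.
Qed.

(** [tr_unique] compares two facets and so yields both that cells are simplices and that they meet
    in common faces. [tr_dual] gives coordinate functionals, from which supporting hyperplanes of
    faces are built; they can be linear, not merely affine, since the vertices of a cell are
    linearly independent. *)
Record triangulates (F : {set {set V}}) (X : set 'rV[R]_n) : Prop := Triangulates {
  tr_cover : forall x, X x -> exists2 A, A \in F & cell A x;
  tr_inside : forall A, A \in F -> (cell A `<=` X)%classic;
  tr_unique : forall A B w w', A \in F -> B \in F -> weight_on A w -> weight_on B w' ->
    bary w = bary w' -> w =1 w';
  tr_dual : forall A v, A \in F -> v \in A ->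
    exists a, {in A, forall u, dotr a (pos u) = (u == v)%:R} }.

Section Tessellation.
Variables (d : nat) (F : {set {set V}}) (X : set 'rV[R]_n).
Hypothesis d2 : (2 <= d)%N.
Hypothesis pm : pseudomanifold d F.
Hypothesis tri : triangulates F X.

Lemma simplex_unique A B w w' : simplex F A -> simplex F B ->
  weight_on A w -> weight_on B w' -> bary w = bary w' -> w =1 w'.
Proof.
move=> /simplexP[A' AF AA'] /simplexP[B' BF BB'] /(weight_sub AA') wA /(weight_sub BB').
exact: (tr_unique tri AF BF wA).
Qed.

Lemma cell_subE A B : simplex F A -> simplex F B ->
  (cell A `<=` cell B)%classic <-> A \subset B.
Proof.
move=> sA sB; split; last exact: cell_sub.
move=> h; apply/fintype.subsetP => v vA; apply/negPn/negP => vB.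
have [w wB e] := h _ (pos_cell vA).
have := simplex_unique sA sB (weight_delta vA) wB; rewrite bary_delta => /(_ e v).
by rewrite eqxx; case: wB => _ _ -> // /eqP; rewrite oner_eq0.
Qed.

Lemma cell_cap A B : simplex F A -> simplex F B ->
  (cell A `&` cell B)%classic = cell (A :&: B).
Proof.
move=> sA sB; rewrite eqEsubset; split=> x; last first.
  by move=> h; split; apply: cell_sub h; rewrite ?subsetIl ?subsetIr.
case=> [[w wA ex] [w' wB ex']]; exists w => //.
have e := simplex_unique sA sB wA wB (etrans (esym ex) ex').
case: wA wB => w0 w1 wA [_ _ wB]; split=> // v.
by rewrite finset.in_setI negb_and => /orP[/wA|/wB] //; rewrite e.
Qed.

(** The sum of the dual functionals over [B] is 1 on [B] and 0 on the rest of [A], so it supports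
    [cell B]. Conversely, the gap between [b] and the functional is a weighted sum of nonnegative
    gaps at the vertices, so it vanishes exactly for weights on the vertices attaining [b]. *)
Lemma face_of_cell A (K : set 'rV[R]_n) : A \in F ->
  face_of (cell A) K <-> exists B, [/\ B != finset.set0, B \subset A & K = cell B].
Proof.
move=> AF; split=> [[K0 [a [b [le_b eK]]]]|[B [B0 BA ->]]]; last first.
  split; first exact/cell_nonempty.
  have /fin_all_exists[c cP] : forall v, exists a, v \in A ->
      {in A, forall u, dotr a (pos u) = (u == v)%:R}.
    move=> v; have [vA|_] := boolP (v \in A); last by exists 0.
    by have [a aP] := tr_dual tri AF vA; exists a.
  have dotc u : u \in A -> dotr (\sum_(v in B) c v) (pos u) = (u \in B)%:R.
    move=> uA; have -> : dotr (\sum_(v in B) c v) (pos u) = \sum_(v in B) dotr (c v) (pos u).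
      rewrite /dotr exchange_big /=; apply: eq_bigr => i _.
      by rewrite summxE mulr_suml.
    rewrite (eq_bigr (fun v => (u == v)%:R)); last first.
      by move=> v vB; rewrite cP // (fintype.subsetP BA).
    have [uB|uB] := boolP (u \in B).
      by rewrite (bigD1 u) //= eqxx big1 ?addr0 // => v /andP[_ /negbTE]; rewrite eq_sym => ->.
    by apply: big1 => v vB; case: eqP uB => // ->; rewrite vB.
  have dotw w : weight_on A w -> dotr (\sum_(v in B) c v) (bary w) = \sum_(v in B) w v.
    move=> wA; rewrite dotr_bary (weight_sum _ wA).
    rewrite (eq_bigr (fun v => if v \in B then w v else 0)); last first.
      by move=> v vA; rewrite dotc //; case: (v \in B); rewrite ?mulr1 ?mulr0.
    rewrite -big_mkcondr; apply: eq_bigl => v; apply/andP/idP => [[]//|vB].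
    by rewrite (fintype.subsetP BA).
  have split_sum w : \sum_v w v = \sum_(v in B) w v + \sum_(v | v \notin B) w v.
    exact: bigID.
  exists (\sum_(v in B) c v), 1; split.
    move=> _ [w wA ->]; rewrite dotw //; case: wA => w0 w1 _.
    by rewrite -w1 split_sum lerDl sumr_ge0.
  rewrite eqEsubset; split=> x; last first.
    case=> -[w wA ->] /=; rewrite dotw // => e; exists w => //.
    case: wA => w0 w1 wA; split=> // v vB.
    have : \sum_(v | v \notin B) w v == 0.
      by move: w1; rewrite split_sum e => /(canRL (addKr _)); rewrite addNr => ->.
    by rewrite psumr_eq0 // => /allP/(_ v (mem_index_enum _)); rewrite vB => /eqP.
  move=> h; split; first exact: cell_sub h.
  case: h => w wB ->; rewrite /= dotw; last exact: weight_sub wB.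
  by case: wB => _ w1 wB; rewrite -w1 split_sum [X in _ = _ + X]big1 ?addr0.
pose B := [set v in A | dotr a (pos v) == b]%SET.
have BA : B \subset A by apply/fintype.subsetP => v; rewrite inE => /andP[].
have aB w : weight_on A w -> (dotr a (bary w) = b <-> weight_on B w).
  move=> wA; have := wA => -[w0 w1 wA0].
  have -> : dotr a (bary w) = b - \sum_v w v * (b - dotr a (pos v)).
    rewrite dotr_bary -[X in X - _]mul1r -w1 mulr_suml -sumrB.
    by apply: eq_bigr => v _; ring.
  have ge0 v : 0 <= w v * (b - dotr a (pos v)).
    have [vA|/wA0 ->] := boolP (v \in A); last by rewrite mul0r.
    by rewrite mulr_ge0 // subr_ge0 le_b //; exact: pos_cell.
  split=> [e|[_ _ wB]].
    split=> // v vB; have [vA|/wA0 //] := boolP (v \in A).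
    have : \sum_v w v * (b - dotr a (pos v)) == 0 by move/eqP: e; rewrite -subr_eq0 addrAC subrr add0r oppr_eq0.
    rewrite psumr_eq0 // => /allP/(_ v (mem_index_enum _)) /=.
    rewrite mulf_eq0 subr_eq0 => /orP[/eqP //|h].
    by rewrite inE vA eq_sym h in vB.
  rewrite big1 ?subr0 // => v _; have [vB|/wB ->] := boolP (v \in B); last by rewrite mul0r.
  by move: vB; rewrite inE => /andP[_ /eqP ->]; rewrite subrr mulr0.
have KB : K = cell B.
  rewrite eK eqEsubset; split=> x.
    by case=> -[w wA ->] /= /(aB _ wA); exists w.
  by case=> w wB ->; have wA := weight_sub BA wB; split; [exists w|apply/(aB _ wA)].
by exists B; split=> //; apply/cell_nonempty; rewrite -KB.
Qed.

Lemma cells_tessellate : tessellation_iso (@face_le V F) d X (fun a : face F => cell (val a)).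
Proof.
have proper (a : face F) : proper_face (@face_le V F) a -> simplex F (val a).
  by rewrite (proper_face_simplex d2 pm) => /andP[].
have properI B : simplex F B -> B != finset.set0 ->
    exists2 a : face F, proper_face (@face_le V F) a & val a = B.
  move=> sB B0; exists (face_of_simplex sB) => //.
  by rewrite (proper_face_simplex d2 pm) /= B0.
have facetP (a : face F) :
    proper_face (@face_le V F) a && (rk (@face_le V F) a == d.+1) <-> val a \in F.
  split=> [/andP[pa]|aF].
    rewrite (rk_face d2 pm) eqSS (fdim_simplex d2 pm (proper a pa)) => /eqP.
    exact: (simplex_facet pm (proper a pa)).
  have [|b pb /val_inj e] := properI _ (facet_simplex aF).
    by rewrite -cards_eq0 (pm_card pm aF) -lt0n ltnW.
  rewrite -e pb (rk_face d2 pm) (fdim_simplex d2 pm) ?e ?facet_simplex //.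
  by rewrite (pm_card pm aF) eqxx.
split.
- by move=> a b /proper sa /proper sb; apply: iff_sym; exact: cell_subE.
- move=> a /proper /simplexP[A AF aA]; move=> x /(cell_sub aA).
  exact: (tr_inside tri AF).
- move=> x /(tr_cover tri)[A AF Ax]; exists (face_of_simplex (facet_simplex AF)).
  by split=> //; apply/facetP.
(* The tiles are already convex hulls of their vertices, so the homeomorphism is the identity. *)
- move=> a /facetP aF; exists n, [seq pos v | v <- enum (val a)], id.
  have [v va] : exists v, v \in val a.
    by apply/card_gt0P; rewrite (pm_card pm aF) ltnW.
  rewrite (conv_hull_cell va); split.
  + have idc (B : set 'rV[R]_n) : {within B, continuous (@id 'rV[R]_n)}%classic.
      by apply: continuous_subspaceT => x; exact: cvg_id.
    by split; [exact: idc|exists id; split=> //; exact: idc].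
  + move=> b /[dup] pb /proper sb ba; exists (cell (val b)); rewrite image_id; split=> //.
    apply/(face_of_cell _ aF); exists (val b); split=> //.
    by move: pb; rewrite (proper_face_simplex d2 pm) => /andP[].
  + move=> K /(face_of_cell _ aF)[B [B0 Ba ->]]; rewrite image_id.
    have [b pb eb] := properI B (simplex_sub Ba (facet_simplex aF)) B0.
    by exists b; rewrite /face_le eb.
- move=> a b /facetP aF /facetP bF; have sa := facet_simplex aF; have sb := facet_simplex bF.
  rewrite cell_cap //; have [/eqP e|ne] := boolP (val a :&: val b == finset.set0).
    left; apply/eqP; apply: contraT => /set0P/cell_nonempty; rewrite e eqxx.
    by [].
  right; have [c pc ec] := properI _ (simplex_sub (subsetIl _ _) sa) ne.
  by exists c; rewrite ec.
Qed.

End Tessellation.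
End Cells.

(** * Subdividing facets geometrically at their barycentres *)

Section StackGeometry.
Variables (R : realType) (n : nat) (V : finType) (pos : V -> 'rV[R]_n).
Variables (d : nat) (F M : {set {set V}}) (X : set 'rV[R]_n).
Hypothesis d3 : (3 <= d)%N.
Hypothesis MF : M \subset F.
Hypothesis pm : pseudomanifold d F.
Hypothesis tri : triangulates pos F X.
Local Notation M_ := {A : {set V} | A \in M}.
Local Notation svert := (svert M).
Local Notation stack := (stack F M).
Implicit Types (A B : {set V}) (v u : V) (w : V -> R) (m : M_) (Y : {set svert}).

Definition stack_pos (q : svert) : 'rV[R]_n :=
  match q with
  | inl v => pos v
  | inr m => d%:R^-1 *: \sum_(v in val m) pos v
  end.

(** The same point in terms of old vertices: the mass of each new vertex is shared equally among the
    [d] vertices of its facet. *)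
Definition push (w' : svert -> R) v : R := w' (inl v) + \sum_(m : M_ | v \in val m) w' (inr m) / d%:R.

Let dN0 : d%:R != 0 :> R. Proof. by rewrite pnatr_eq0 -lt0n ltnW // ltnW. Qed.

Lemma dotr_sum (P : pred V) (a : 'rV[R]_n) (c : R) :
  dotr a (c *: \sum_(v | P v) pos v) = c * \sum_(v | P v) dotr a (pos v).
Proof.
rewrite /dotr exchange_big /= mulr_sumr; apply: eq_bigr => i _.
by rewrite !mxE summxE mulrCA mulr_sumr.
Qed.

Lemma dotrZ (a x : 'rV[R]_n) (c : R) : dotr (c *: a) x = c * dotr a x.
Proof. by rewrite /dotr mulr_sumr; apply: eq_bigr => i _; rewrite mxE mulrA. Qed.

Lemma bary_push (w' : svert -> R) : bary stack_pos w' = bary pos (push w').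
Proof.
rewrite /bary big_sumType /=.
under [in RHS]eq_bigr => v _ do rewrite scalerDl scaler_suml.
rewrite big_split /=; congr (_ + _).
rewrite (exchange_big_dep xpredT) //=; apply: eq_bigr => m _.
by rewrite scalerA scaler_sumr.
Qed.

Lemma sum_push (w' : svert -> R) : \sum_v push w' v = \sum_q w' q.
Proof.
rewrite /push big_split big_sumType /=; congr (_ + _).
rewrite (exchange_big_dep xpredT) //=; apply: eq_bigr => m _.
by rewrite sumr_const (pm_card pm (valMF MF m)) -[LHS]mulr_natr divfK.
Qed.

Lemma push_ge0 (w' : svert -> R) v : (forall q, 0 <= w' q) -> 0 <= push w' v.
Proof.
move=> w0; rewrite addr_ge0 // sumr_ge0 // => m _.
by rewrite divr_ge0 // ler0n.
Qed.

Lemma push_weight Y (w' : svert -> R) : Y \in stack -> weight_on Y w' -> weight_on (parent Y) (push w').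
Proof.
move=> YS [w0 w1 wY]; split=> [v||v vY]; first exact: push_ge0.
  by rewrite sum_push.
rewrite /push wY ?add0r; last first.
  apply: contra vY => vY; apply: (fintype.subsetP (trace_parent YS)).
  by rewrite inE.
apply: big1 => m vm; rewrite wY ?mul0r //; apply: contra vY => mY.
by rewrite (parent_inr YS mY).
Qed.

(* The mass of the new vertex over m is d times the minimum of the pushed
   weights on m, so the weights can be recovered from the pushed ones. *)
Lemma push_min Y (w' : svert -> R) m : Y \in stack -> weight_on Y w' ->
  {in val m, forall v, w' (inr m) / d%:R <= push w' v} /\
  exists2 v, v \in val m & push w' v = w' (inr m) / d%:R.
Proof.
move=> YS wY; have [w0 w1 wY0] := wY.
have t0 m' : 0 <= w' (inr m') / d%:R by rewrite divr_ge0 // ler0n.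
have [mY|mY] := boolP ((inr m : svert) \in Y); last first.
  rewrite wY0 // mul0r; split=> [v _|]; first exact: push_ge0.
  (* Here [m] is not the parent of [Y], so some vertex of [m] lies outside the parent and has pushed
     weight 0. *)
  have [v vm vY] : exists2 v, v \in val m & v \notin parent Y.
    apply/subsetPn; apply: contra mY => mp.
    have e : val m = parent Y.
      apply/eqP; rewrite eqEcard mp (pm_card pm (valMF MF m)).
      by rewrite (pm_card pm (parent_facet MF YS)) leqnn.
    case/stackP: YS e {wY wY0 mp} => [A AF AM ->|m' x xm ->].
      by rewrite parent_old => e; rewrite -e (valP m) in AM.
    by rewrite parent_child // => /val_inj ->; rewrite inr_child.
  by exists v => //; have [_ _ ->] := push_weight YS wY.
split=> [v vm|].
  by rewrite /push (bigD1 m) //= addrCA lerDl addr_ge0 // sumr_ge0.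
case/stackP: YS mY wY0 {wY} => [A AF AM ->|m' x xm ->]; first by rewrite inr_old.
rewrite inr_child => /eqP e; subst m' => wY0; exists x => //.
(* The vertex omitted by the child gets mass from the new vertex only. *)
rewrite /push wY0 ?add0r; last by rewrite mem_child eqxx.
rewrite (bigD1 m) //= big1 ?addr0 // => m' /andP[_ nm].
by rewrite wY0 ?mul0r // inr_child.
Qed.

Lemma stack_triangulates : triangulates stack_pos stack X.
Proof.
split.
- move=> _ /(tr_cover tri)[A AF [w wA ->]]; have [w0 w1 wA0] := wA.
  have [AM|AM] := boolP (A \in M); last first.
    exists (old M A); first exact: old_stack.
    pose w' (q : svert) := if q is inl v then w v else 0.
    have pE v : push w' v = w v by rewrite /push big1 ?addr0 // => m _; rewrite mul0r.
    exists w'; last by rewrite bary_push; apply: eq_bigr => v _; rewrite pE.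
    split=> [[v|m]||[v|m]] //=.
      by rewrite -sum_push -w1; apply: eq_bigr => v _; rewrite pE.
    by rewrite mem_old => /wA0.
  pose mA : M_ := exist _ A AM.
  have [v0 v0A] : exists v, v \in A.
    by apply/card_gt0P; rewrite (pm_card pm AF) ltnW // ltnW.
  (* Taking the least weight away from every vertex of [A] and giving [d] times it to the barycentre
     keeps the point and empties [x], so the point lies in the child opposite to [x]. *)
  have [x xA xmin] : exists2 x, x \in A & {in A, forall v, w x <= w v}.
    case: (@Order.TotalTheory.arg_minP _ _ _ v0 (mem A) w v0A) => x xA h.
    by exists x => // v /h.
  pose w' (q : svert) := match q with
    | inl v => w v - (v \in A)%:R * w x
    | inr m => (m == mA)%:R * (d%:R * w x) end.
  have pE v : push w' v = w v.
    rewrite /push; have [vA|vA] := boolP (v \in A); last first.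
      rewrite /= (negbTE vA) mul0r subr0 big1 ?addr0 // => m vm.
      by case: eqP vm => [->|_]; rewrite ?(negbTE vA) ?mul0r // mul0r.
    rewrite (bigD1 mA) //= eqxx vA !mul1r mulrC mulKf // big1 ?addr0 ?subrK // => m.
    by case/andP=> _ /negbTE ->; rewrite !mul0r.
  exists (child mA x); first exact: child_stack.
  exists w'; last by rewrite bary_push; apply: eq_bigr => v _; rewrite pE.
  split=> [[v|m]||[v|m]].
  + rewrite /=; have [vA|_] := boolP (v \in A); last by rewrite mul0r subr0.
    by rewrite mul1r subr_ge0 xmin.
  + by rewrite /= !mulr_ge0 ?ler0n.
  + by rewrite -sum_push -w1; apply: eq_bigr => v _; rewrite pE.
  + rewrite mem_child negb_and negbK /= => /orP[/eqP ->|vA].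
      by rewrite xA mul1r subrr.
    by rewrite (negbTE vA) mul0r subr0 wA0.
  + by rewrite inr_child /= => /negbTE ->; rewrite mul0r.
- move=> Y YS _ [w' wY ->]; rewrite bary_push.
  apply: (tr_inside tri (parent_facet MF YS)).
  by exists (push w') => //; exact: push_weight.
- move=> Y Z w1 w2 YS ZS wY wZ; rewrite !bary_push.
  move/(tr_unique tri (parent_facet MF YS) (parent_facet MF ZS)
    (push_weight YS wY) (push_weight ZS wZ)) => e.
  (* The pushed weights coincide, so by [push_min] they have the same minimum on [m], which
     determines the mass at its barycentre. *)
  have em m : w1 (inr m) = w2 (inr m).
    have [l1 [v1 v1m e1]] := push_min m YS wY.
    have [l2 [v2 v2m e2]] := push_min m ZS wZ.
    have : w1 (inr m) / d%:R == w2 (inr m) / d%:R.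
      by rewrite eq_le -{1}e2 -e l1 //= -e1 e l2.
    by move/eqP/(mulIf _); apply; rewrite invr_neq0.
  case=> [v|//]; have := e v; rewrite /push.
  under eq_bigr => m _ do rewrite em.
  exact: addIr.
- move=> Y q YS; case/stackP: YS => [A AF AM ->|m x xm ->].
    case: q => [v|m]; last by rewrite inr_old.
    rewrite mem_old => /(tr_dual tri AF)[a aP]; exists a => -[u|m].
      by rewrite mem_old => /aP.
    by rewrite inr_old.
  have mF := valMF MF m; have [ax axP] := tr_dual tri mF xm.
  have dual_sum a v : v \in val m -> {in val m, forall u, dotr a (pos u) = (u == v)%:R} ->
      dotr a (stack_pos (inr m)) = d%:R^-1.
    move=> vm aP; rewrite /= dotr_sum (eq_bigr (fun u => (u == v)%:R)) //.
    rewrite (bigD1 v) //= eqxx big1 ?addr0 ?mulr1 // => u /andP[_ /negbTE ->].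
    by [].
  case: q => [v|m'].
    rewrite mem_child => /andP[vx vm]; have [a aP] := tr_dual tri mF vm.
    (* Both functionals equal [1/d] at the barycentre, so the difference vanishes there; the factor
       1 only fits [dotrDZ]. *)
    exists (a - 1 *: ax) => -[u|m''].
      rewrite mem_child => /andP[ux um]; rewrite dotrDZ mul1r /= aP // axP //.
      by rewrite (negbTE ux) subr0.
    rewrite inr_child => /eqP ->; rewrite dotrDZ mul1r (dual_sum a v) // (dual_sum ax x) //.
    by rewrite subrr.
  rewrite inr_child => /eqP ->; exists (d%:R *: ax) => -[u|m''].
    by rewrite mem_child => /andP[ux um]; rewrite dotrZ /= axP // (negbTE ux) mulr0.
  by rewrite inr_child => /eqP ->; rewrite dotrZ (dual_sum ax x) // mulfV // eqxx.
Qed.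

Lemma cell_old A : cell stack_pos (old M A) = cell pos A.
Proof.
rewrite eqEsubset; split=> _ [w [w0 w1 wA] ->].
  exists (push w); last exact: bary_push.
  split=> [v||v vA]; first exact: push_ge0.
    by rewrite sum_push.
  rewrite /push wA ?mem_old // add0r big1 // => m _.
  by rewrite wA ?mul0r // inr_old.
pose w' (q : svert) := if q is inl v then w v else 0.
have pE v : push w' v = w v by rewrite /push big1 ?addr0 // => m _; rewrite mul0r.
exists w'; last by rewrite bary_push; apply: eq_bigr => v _; rewrite pE.
split=> [[v|m]||[v|m]] //=.
  by rewrite -sum_push -w1; apply: eq_bigr => v _; rewrite pE.
by rewrite mem_old => /wA.
Qed.

End StackGeometry.

(** * The order complex triangulates its realization *)

Section OrderComplexGeometry.
Variables (R : realType) (T : finType) (le : rel T) (d : nat).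
Hypothesis d3 : (3 <= d)%N.
Hypothesis poly : abstract_polytope le d.
Local Notation pface := (pface le).
Implicit Types (A B : {set pface}) (v u : pface) (w : pface -> R) (x : 'rV[R]_#|T|).

Definition oc_pos v : 'rV[R]_#|T| := delta_mx 0 (enum_rank (val v)).

Lemma bcoord_bary w (y : T) : bcoord (bary oc_pos w) y = \sum_v w v * (y == val v)%:R.
Proof.
rewrite /bcoord /bary summxE; apply: eq_bigr => v _.
by rewrite !mxE (inj_eq enum_rank_inj).
Qed.

Lemma bcoord_val w v : bcoord (bary oc_pos w) (val v) = w v.
Proof.
rewrite bcoord_bary (bigD1 v) //= eqxx mulr1 big1 ?addr0 // => u uv.
by rewrite (inj_eq val_inj) eq_sym (negbTE uv) mulr0.
Qed.

Lemma cell_embed A : cell oc_pos A = geom_simplex (embed A).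
Proof.
rewrite eqEsubset; split=> [_ [w [w0 w1 wA] ->]|x [x0 x1 xA]].
  split.
  - move=> y; rewrite bcoord_bary sumr_ge0 // => v _.
    by rewrite mulr_ge0 // ler0n.
  - under eq_bigr => y _ do rewrite bcoord_bary.
    rewrite exchange_big /= -[RHS]w1; apply: eq_bigr => v _.
    by rewrite (bigD1 (val v)) //= eqxx mulr1 big1 ?addr0 // => y /negbTE ->; rewrite mulr0.
  - move=> y; apply: contraR => yA; rewrite bcoord_bary big1 // => v _.
    case: eqP yA => [->|_ _]; last by rewrite mulr0.
    by rewrite mem_embed => /wA ->; rewrite mul0r.
have x0A y : y \notin embed A -> bcoord x y = 0.
  by move=> yA; apply/eqP; apply: contraNT yA => /xA.
exists (fun v => bcoord x (val v)).
  split=> [v||v vA]; first exact: x0.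
    rewrite -x1 [RHS](bigID (mem (embed A))) /= [X in _ = _ + X]big1 ?addr0 //.
    rewrite big_imset /=; last by move=> ? ? _ _; exact: val_inj.
    rewrite (bigID (mem A)) /= [X in _ + X]big1 ?addr0 // => v vA.
    by rewrite x0A // mem_embed.
  by rewrite x0A // mem_embed.
apply/rowP => i; rewrite -(enum_valK i) -/(bcoord x _) -/(bcoord (bary _ _) _).
move: (enum_val i) => y; have [/imsetP[v _ ->]|yA] := boolP (y \in embed A).
  by rewrite bcoord_val.
rewrite x0A // bcoord_bary big1 // => v _.
have [e|_] := eqVneq y (val v); last by rewrite mulr0.
by rewrite x0A ?mul0r // -e.
Qed.

Lemma oc_triangulates : triangulates oc_pos (oc_facets le d) (@realization R _ le).
Proof.
have [po [bot le_bot] [top le_top] flagN [diam sfc]] := poly.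
have pm := oc_pseudomanifold d3 po le_bot le_top flagN diam sfc.
split.
- move=> x [c [/and3P[ch c0 /forall_inP cp] gx]].
  pose A : {set pface} := facet_of le c.
  have eA : embed A = c.
    apply/setP => y; apply/imsetP/idP => [[v]|yc]; first by rewrite inE => ? ->.
    by exists (Sub y (cp y yc)); rewrite ?inE ?SubK.
  have : is_chain le (embed A) by rewrite eA.
  case/(chain_oc_facet d3 po le_bot le_top flagN) => B BF AB.
  by exists B => //; apply: (cell_sub AB); rewrite cell_embed eA.
- move=> A AF x; rewrite cell_embed => gx; exists (embed A); split=> //.
  have := AF; rewrite inE => /andP[ch /eqP cA]; apply/and3P; split=> //.
    by rewrite -cards_eq0 card_embed cA -lt0n ltnW // ltnW.
  by apply/forall_inP => y /imsetP[v _ ->]; exact: (valP v).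
- move=> A B w w' _ _ _ _ e v.
  by rewrite -(bcoord_val w) e bcoord_val.
- move=> A v _ _; exists (oc_pos v) => u _.
  rewrite /dotr (bigD1 (enum_rank (val v))) //= big1 ?addr0 => [|i iv].
    by rewrite !mxE !eqxx mul1r (inj_eq enum_rank_inj) (inj_eq val_inj) eq_sym.
  by rewrite !mxE (negbTE iv) mul0r.
Qed.

End OrderComplexGeometry.

(** * Rigidification *)

Section Stages.
Variables (R : realType) (n d : nat) (X : set 'rV[R]_n).
Variables (gT : finGroupType) (G : {group gT}) (K : nat -> set 'rV[R]_n -> Prop).
Hypothesis d3 : (3 <= d)%N.
Hypothesis Kd : forall k C, K k C -> (k < d)%N.

(* [tau] is a facet with free orbit; the vertices in [U] are those of tau that an
   automorphism respecting the orbit of tau might still move freely. *)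
Record stage (V : finType) (F : {set {set V}}) (pos : V -> 'rV[R]_n)
    (rho : gT -> V -> V) (tau U : {set V}) : Prop := Stage {
  st_pm : pseudomanifold d F;
  st_tri : triangulates pos F X;
  st_small : forall k C, K k C ->
    exists B : {set V}, [/\ simplex F B, #|B| = k & cell pos B = C];
  st_aut : {in G, forall g, simplicial_aut F (rho g)};
  st_mul : {in G &, forall g h v, rho (g * h)%g v = rho h (rho g v)};
  st_tau : tau \in F;
  st_free : {in G, forall g, rho g @: tau = tau -> g = 1%g};
  st_degree : forall v, (d <= degree F v)%N /\
    (degree F v = d -> exists2 g, g \in G & v \in rho g @: tau);
  st_sub : U \subset tau;
  st_rigid : forall f g, simplicial_aut F f -> g \in G -> f @: tau = rho g @: tau ->
    {in tau :\: U, f =1 rho g} }.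

Section Next.
Variables (V : finType) (F : {set {set V}}) (pos : V -> 'rV[R]_n).
Variables (rho : gT -> V -> V) (tau U : {set V}).
Hypothesis st : stage F pos rho tau U.

Definition facet_orbit : {set {set V}} := [set rho g @: tau | g in G].
Local Notation M := facet_orbit.

Let pm := st_pm st.

(** [st_mul] makes [rho 1] idempotent, and it is injective. *)
Lemma stage_one v : rho 1%g v = v.
Proof.
have [ri _] := st_aut st (group1 G).
by apply: ri; rewrite -(st_mul st) ?group1 // mulg1.
Qed.

Lemma tau_orbit : tau \in M.
Proof.
apply/imsetP; exists 1%g; first exact: group1.
by rewrite (eq_imset _ stage_one) imset_id.
Qed.

Lemma orbit_sub : M \subset F.
Proof.
apply/fintype.subsetP => _ /imsetP[g gG ->].
by have [_] := st_aut st gG; apply; exact: st_tau st.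
Qed.

Lemma orbit_preserved : {in G, forall g, preserves M (rho g)}.
Proof.
move=> g gG _ /imsetP[h hG ->]; apply/imsetP; exists (h * g)%g; first exact: groupM.
by rewrite -imset_comp; apply: eq_imset => v /=; rewrite (st_mul st).
Qed.

Definition tauM : {A : {set V} | A \in M} := exist _ tau tau_orbit.

(** By [st_degree], a vertex whose degree is only [d] lies in the orbit being subdivided, and there
    the degree grows. *)
Lemma stage_old_degree v : (d < degree (stack F M) (inl v))%N.
Proof.
have [dv h] := st_degree st v.
apply: leq_trans (degree_old d3 orbit_sub pm v).
move: dv; rewrite leq_eqVlt => /orP[/eqP e|lt]; last exact: leq_trans (leq_addr _ _).
have [g gG vg] := h (esym e).
have -> : v \in finset.cover M by apply/finset.bigcupP; exists (rho g @: tau) => //; exact: imset_f.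
by rewrite -e addn1.
Qed.

Lemma stage_stack_aut f : simplicial_aut (stack F M) f ->
  exists f', [/\ simplicial_aut F f', preserves M f' & f =1 smap f'].
Proof.
apply: (stack_aut d3 orbit_sub pm) => v.
by rewrite gtn_eqF // stage_old_degree.
Qed.

Lemma stage_smap_aut : {in G, forall g, simplicial_aut (stack F M) (smap (rho g))}.
Proof. by move=> g gG; apply: smap_aut (st_aut st gG) (orbit_preserved gG). Qed.

Lemma stage_smapM : {in G &, forall g h (q : svert M),
  smap (rho (g * h)%g) q = smap (rho h) (smap (rho g) q)}.
Proof.
move=> g h gG hG [v|m]; first by rewrite /= (st_mul st).
have [m1 -> e1] := smap_inr m (orbit_preserved (groupM gG hG)).
have [m2 -> e2] := smap_inr m (orbit_preserved gG).
have [m3 -> e3] := smap_inr m2 (orbit_preserved hG).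
congr inr; apply: val_inj; rewrite e1 e3 e2 -imset_comp.
by apply: eq_imset => v /=; rewrite (st_mul st).
Qed.

(** [K] lists the point sets, with their numbers of vertices, that must stay cells; fewer than [d]
    vertices is what [stack_simplex] needs. *)
Lemma stage_small k C : K k C ->
  exists B : {set svert M}, [/\ simplex (stack F M) B, #|B| = k & cell (stack_pos pos d (M := M)) B = C].
Proof.
move=> KC; have [B [sB cB eB]] := st_small st KC; exists (old M B); split.
- by apply: (stack_simplex M pm) => //; rewrite cB; exact: Kd KC.
- by rewrite card_old.
- by rewrite (cell_old pos d3 orbit_sub pm).
Qed.

Lemma smap_tau f u : injective f -> preserves M f -> exists m,
  [/\ smap f (inr tauM) = inr m, val m = f @: tau & smap f @: child tauM u = child m (f u)].
Proof.
move=> fi fM; have [m e em] := smap_inr tauM fM.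
by exists m; split=> //; exact: smap_child.
Qed.

(** The child opposite to [u] trades [u] for a new vertex that automorphisms must respect, so [u]
    leaves the set of uncontrolled vertices. *)
Lemma stage_next u : u \in tau ->
  stage (stack F M) (stack_pos pos d (M := M)) (fun g => smap (rho g))
    (child tauM u) (old M (U :\ u)).
Proof.
move=> ut; split.
- exact: stack_pseudomanifold d3 orbit_sub pm.
- exact: stack_triangulates d3 orbit_sub pm (st_tri st).
- exact: stage_small.
- exact: stage_smap_aut.
- exact: stage_smapM.
- exact: child_stack.
(* Fixing the child fixes its only new vertex, hence [tau], and the orbit of [tau] was free. *)
- move=> g gG; have [gi _] := st_aut st gG.
  have [m [_ em ->]] := smap_tau u gi (orbit_preserved gG) => /setP/(_ (inr m)).
  rewrite !inr_child eqxx => /esym/eqP e; apply: (st_free st gG).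
  by rewrite -em e.
- case=> [v|m].
    split; first exact/ltnW/stage_old_degree.
    by move=> e; have := stage_old_degree v; rewrite e ltnn.
  rewrite (degree_new orbit_sub pm); split=> // _.
  have /imsetP[g gG eg] := valP m; exists g => //.
  have [gi _] := st_aut st gG.
  have [m' [_ em' ->]] := smap_tau u gi (orbit_preserved gG).
  by rewrite inr_child -val_eqE /= em' eg.
- by rewrite old_sub_child; apply: finset.setSD; exact: st_sub st.
(* Comparing the new vertices of the two images shows that [f'] and [rho g] send [tau] to the same
   facet; the earlier rigidity then settles the old vertices. *)
- move=> f g fA gG; have [f' [f'A f'M fE]] := stage_stack_aut fA.
  have [gi _] := st_aut st gG; have [f'i _] := f'A.
  rewrite (eq_imset _ fE).
  have [m1 [em1 v1 ->]] := smap_tau u f'i f'M.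
  have [m2 [em2 v2 ->]] := smap_tau u gi (orbit_preserved gG).
  move/setP/(_ (inr m1)); rewrite !inr_child eqxx => /esym/eqP e12.
  have e : f' @: tau = rho g @: tau by rewrite -v1 e12 v2.
  move=> [v|m]; rewrite finset.in_setD fE.
    rewrite mem_old mem_child in_setD1 => /andP[nvU /andP[vu vt]] /=.
    congr inl; apply: (st_rigid st f'A gG e); rewrite finset.in_setD vt andbT.
    by apply: contra nvU => ->; rewrite vu.
  by rewrite inr_child => /andP[_ /eqP ->]; rewrite em1 em2 e12.
Qed.

(** Automorphisms of the stacked complex descend to maps preserving the orbit of [tau]; one element
    of [G] matches such a map on [tau], and [aut_rigid] does the rest. *)
Lemma stage_rigid f : U = finset.set0 -> simplicial_aut (stack F M) f ->
  exists2 g, g \in G & f =1 smap (rho g).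
Proof.
move=> U0 fA; have [f' [f'A f'M fE]] := stage_stack_aut fA.
have /imsetP[g gG e] := f'M _ tau_orbit; exists g => //.
have f'E : f' =1 rho g.
  apply: (aut_rigid pm f'A (st_aut st gG) (st_tau st)) => v vt.
  by apply: (st_rigid st f'A gG e); rewrite U0 finset.setD0.
move=> q; rewrite fE; case: q => [v|m] /=; first by rewrite f'E.
by rewrite (eq_imset _ f'E).
Qed.

End Next.

Lemma stage_exhaust (V : finType) (F : {set {set V}}) pos rho (tau U : {set V}) :
  stage F pos rho tau U ->
  exists (V' : finType) (F' : {set {set V'}}) pos' rho' tau',
    stage F' pos' rho' tau' finset.set0.
Proof.
have [k] := ubnP #|U|; elim: k => // k IH in V F pos rho tau U * => cU st.
have [U0|[u uU]] := finset.set_0Vmem U.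
  by rewrite U0 in st; exists V, F, pos, rho, tau.
have ut : u \in tau := fintype.subsetP (st_sub st) u uU.
apply: IH (stage_next st ut); rewrite card_old.
by move: cU; rewrite (cardsD1 u) uU.
Qed.

(** Exhausting [U] controls only automorphisms already known to send [tau] into its orbit. One
    further stacking provides that knowledge through [stage_rigid]. *)
Lemma stage_realize (V : finType) (F : {set {set V}}) pos rho (tau U : {set V}) :
  stage F pos rho tau U ->
  exists (TP : finType) (leP : rel TP),
    [/\ abstract_polytope leP d, isog (Aut_poset leP) G
      & exists cl : TP -> set 'rV[R]_n, tessellation_iso leP d X cl /\
        (forall k C, K k C -> (0 < k)%N ->
          exists a, [/\ proper_face leP a, rk leP a = (k + 1)%N & cl a = C])].
Proof.
case/stage_exhaust => {F pos rho tau U}V' [F [pos [rho [tau st]]]].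
have d2 : (2 <= d)%N := ltnW d3.
have [u ut] : exists u, u \in tau.
  by apply/card_gt0P; rewrite (pm_card (st_pm st) (st_tau st)) ltnW.
have st' := stage_next st ut; have pm := st_pm st'.
exists (face (stack F (facet_orbit rho tau))), (@face_le _ _); split.
- exact: face_polytope d2 pm.
- apply: (aut_face_isog d2 pm (rho := fun g => smap (rho g))).
  + exact: st_aut st'.
  + exact: st_mul st'.
  + move=> g gG e; apply: (st_free st' gG).
    by rewrite (eq_imset _ e) imset_id.
  + by move=> f fA; exact: (stage_rigid st).
exists (fun a => cell (stack_pos pos d (M := facet_orbit rho tau)) (val a)); split.
  exact: cells_tessellate d2 pm (st_tri st').
move=> k C KC k0; have [B [sB cB eB]] := st_small st' KC.
exists (face_of_simplex sB); split=> //.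
  by rewrite (proper_face_simplex d2 pm) /= sB andbT -cards_eq0 cB -lt0n.
by rewrite (rk_face d2 pm) fdim_simplex // cB addn1.
Qed.

End Stages.

(** * Conclusion, starting from the order complex as initial stage *)

Local Open Scope classical_set_scope.

Theorem theorem3 (R : realType) (d : nat) (TQ : finType) (leQ : rel TQ)
    (Gamma : {group {perm TQ}}) :
  (3 <= d)%N -> abstract_polytope leQ d -> Gamma \subset Aut_poset leQ ->
  exists (TP : finType) (leP : rel TP),
    [/\ abstract_polytope leP d,
        (* (a) Gamma(P) = Gamma *)
        isog (Aut_poset leP) Gamma
      & exists cell : TP -> set 'rV[R]_#|TQ|,
          (* (b) *)
          tessellation_iso leP d (@realization R _ leQ) cell /\
          (* (c) skel_{d-2}(C(Q)) is a subcomplex of skel_{d-2}(P):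
             every simplex of C(Q) of dimension #|c|-1 <= d-2 is, unrefined,
             the cell of a face of P of the same rank *)
          (forall c : {set TQ}, oc_simplex leQ c -> (#|c| <= d - 1)%N ->
             exists G, [/\ proper_face leP G, rk leP G = (#|c| + 1)%N
                         & cell G = @geom_simplex R _ c])].
Proof.
move=> d3 poly GA.
have [po [bot le_bot] [top le_top] flagN [diam sfc]] := poly.
have pm := oc_pseudomanifold d3 po le_bot le_top flagN diam sfc.
have [tau tauF] := pm_facet pm.
(* Fewer than [d] vertices means dimension at most [d - 2]. *)
pose K k (C : set 'rV[R]_#|TQ|) := exists c : {set TQ},
  [/\ oc_simplex leQ c, (#|c| < d)%N, k = #|c| & C = geom_simplex c].
have Kd k C : K k C -> (k < d)%N by case=> c [_ cd -> _].
have gA g : g \in Gamma -> g \in Aut_poset leQ by exact: fintype.subsetP.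
have st : stage d (@realization R _ leQ) Gamma K (oc_facets leQ d)
    (@oc_pos R _ leQ) (oc_act (le := leQ)) tau tau.
  split=> //.
  - exact: oc_triangulates.
  - move=> k _ [c [/and3P[ch _ /forall_inP cp] cd -> ->]].
    have ec : embed (facet_of leQ c) = c.
      apply/setP => y; apply/imsetP/idP => [[v]|yc]; first by rewrite inE => ? ->.
      by exists (Sub y (cp y yc)); rewrite ?inE ?SubK.
    exists (facet_of leQ c); rewrite cell_embed ec; split=> //.
      have : is_chain leQ (embed (facet_of leQ c)) by rewrite ec.
      by case/(chain_oc_facet d3 po le_bot le_top flagN) => B BF sB; apply/simplexP; exists B.
    by rewrite -card_embed ec.
  - by move=> g gG; exact: oc_act_aut (gA g gG).
  - by move=> g h gG hG v; apply: oc_actM; rewrite ?gA ?groupM.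
  - by move=> g gG; exact: oc_act_free (gA g gG) tauF.
  (* All degrees in the order complex exceed [d], so the clause on vertices of degree [d] is
     vacuous. *)
  - move=> v; have clique := @oc_clique TQ leQ d bot top d3 po le_bot le_top flagN.
    have dv := clique_complex_degree d3 pm clique v.
    split; first exact: ltnW.
    by move=> e; rewrite e ltnn in dv.
  (* With [U = tau] no vertex is claimed to be rigid yet. *)
  - by move=> f g fA gG e v; rewrite finset.setDv inE.
have [TP [leP [polyP isoP [cl [tess small]]]]] := stage_realize d3 Kd st.
exists TP, leP; split=> //; exists cl; split=> // c sc cd.
apply: small; last by have /and3P[_ c0 _] := sc; rewrite lt0n cards_eq0.
exists c; split=> //; move: cd d3; clear; lia.
Qed.
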